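(* Let $\mathcal{H}=\bigotimes_{i=1}^n\mathcal{H}_i$ with $\dim\mathcal{H}_i=d_i$. For every unitary $U\in U(d_1\cdots d_n)$ and every non-trivial unordered bipartition $p|q$ of $\{1,\dots,n\}$, $\epsilon_{p|q}(U)\le\tilde\epsilon_{p|q}$, and consequently $\epsilon_1(U)\le\tilde\epsilon_1:=\frac{1}{2^{n-1}-1}\sum_{p|q}\tilde\epsilon_{p|q}$, where $$\tilde\epsilon_{p|q}:=2-2\Bigg(\prod_{i=1}^n\frac{d_i}{d_i+1}\Bigg)\left[2^n-\sum_{x'|y'}\frac{\min(d_{px'},d_{qy'})-1}{\min(d_{px'},d_{qy'})}\right],$$ the sum being over all $2^n$ ordered bipartitions $x'|y'$ of $\{1',\dots,n'\}$ (including trivial ones), $d_{px'}=\prod_{i\in p}d_i\prod_{i'\in x'}d_i$ and $d_{qy'}=\prod_{i\in q}d_i\prod_{i'\in y'}d_i$.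
   Context: For a pure state $|\psi\rangle\in\mathcal{H}$ and a bipartition $p|q$ of $\{1,\dots,n\}$, $\tau_{p|q}(|\psi\rangle)=2\big(1-\operatorname{tr}[(\operatorname{tr}_p|\psi\rangle\langle\psi|)^2]\big)$; the $n$-party one-tangle is $\tau_1=\frac{1}{2^{n-1}-1}\sum_{p|q}\tau_{p|q}$ (sum over non-trivial unordered bipartitions). $\epsilon_{p|q}(U)$ (resp. $\epsilon_1(U)$) is the average of $\tau_{p|q}(U|\psi_{\rm sep}\rangle)$ (resp. $\tau_1(U|\psi_{\rm sep}\rangle)$) over $|\psi_{\rm sep}\rangle=|\psi_1\rangle\otimes\cdots\otimes|\psi_n\rangle$, each $|\psi_i\rangle$ drawn independently from the unitarily invariant measure on pure states of $\mathcal{H}_i$. The primed labels $1',\dots,n'$ refer to a copy $\mathcal{H}'=\bigotimes_i\mathcal{H}_{i'}$ of $\mathcal{H}$, $\dim\mathcal{H}_{i'}=d_i$. *)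

(* Defs.v *)
From HB Require Import structures.
From mathcomp Require Import all_boot all_order all_algebra.
From mathcomp Require Import all_classical all_reals all_analysis.
From mathcomp.real_closed Require Import complex.
Set Implicit Arguments. Unset Strict Implicit. Unset Printing Implicit Defensive.
Import Order.TTheory GRing.Theory Num.Theory.
Local Open Scope ring_scope.

(** * Multipartite Hilbert space H = H_1 (x) ... (x) H_n, dim H_i = d i.
    Computational basis of H is indexed by [idx d] (a tuple of local indices);
    the basis of the subsystem S (a subset of parties) by [sidx d S]. *)
Definition idx (n : nat) (d : 'I_n -> nat) :=
  {dffun forall i : 'I_n, 'I_(d i)}.
Definition sidx (n : nat) (d : 'I_n -> nat) (S : {set 'I_n}) :=
  {dffun forall i : {i : 'I_n | i \in S}, 'I_(d (val i))}.

Definition restr (n : nat) (d : 'I_n -> nat) (S : {set 'I_n}) (x : idx d)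
  : sidx d S :=
  @finfun _ (fun i : {i : 'I_n | i \in S} => 'I_(d (val i))) (fun i => x (val i)).

Definition state (R : rcfType) (n : nat) (d : 'I_n -> nat) := idx d -> R[i].

Definition unitary (R : rcfType) (n : nat) (d : 'I_n -> nat)
  (U : idx d -> idx d -> R[i]) : Prop :=
  forall x y : idx d, \sum_(z : idx d) (U z x)^* * U z y = (x == y)%:R.

Definition apply_op (R : rcfType) (n : nat) (d : 'I_n -> nat)
  (U : idx d -> idx d -> R[i]) (psi : state R d) : state R d :=
  fun x => \sum_(y : idx d) U x y * psi y.

Definition proj (R : rcfType) (n : nat) (d : 'I_n -> nat) (psi : state R d)
  : idx d -> idx d -> R[i] := fun x y => psi x * (psi y)^*.

(** partial trace over the parties in p: an operator on the subsystem ~: p.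
    Its (a,b) entry is sum_c rho((c,a),(c,b)), c ranging over basis of p. *)
Definition ptrace (R : rcfType) (n : nat) (d : 'I_n -> nat) (p : {set 'I_n})
  (rho : idx d -> idx d -> R[i]) : sidx d (~: p) -> sidx d (~: p) -> R[i] :=
  fun a b => \sum_(x : idx d) \sum_(y : idx d |
      [&& restr (~: p) x == a, restr (~: p) y == b & restr p x == restr p y])
      rho x y.

Definition trsq (R : rcfType) (n : nat) (d : 'I_n -> nat) (S : {set 'I_n})
  (A : sidx d S -> sidx d S -> R[i]) : R[i] :=
  \sum_(a : sidx d S) \sum_(b : sidx d S) A a b * A b a.

Definition tau (R : rcfType) (n : nat) (d : 'I_n -> nat) (p : {set 'I_n})
  (psi : state R d) : R :=
  2 * (1 - complex.Re (@trsq R n d (~: p) (@ptrace R n d p (proj psi)))).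

(** * Averaging over Haar-random product states.
    A Haar (unitarily invariant) random pure state of C^k is realised as
    g / |g| with g a standard complex Gaussian vector of C^k.  The real
    Gaussian coordinates are indexed by [key d]: (party i, basis vector k,
    real/imaginary part). *)
Definition key (n : nat) (d : 'I_n -> nat) := ({i : 'I_n & 'I_(d i)} * bool)%type.

Fixpoint gint (R : realType) (K : eqType) (s : seq K)
  (F : (K -> R) -> \bar R) (env : K -> R) : \bar R :=
  match s with
  | [::] => F env
  | k :: s' => (\int[@lebesgue_measure R]_t
      ((expR (- t ^+ 2) / Num.sqrt pi)%:E *
         gint s' F (fun j => if j == k then t else env j)))%E
  end.

Definition gauss_avg (R : realType) (K : finType) (F : (K -> R) -> \bar R)
  : \bar R := gint (enum K) F (fun _ => 0).

Definition local_state (R : rcfType) (n : nat) (d : 'I_n -> nat)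
  (g : key d -> R) (i : 'I_n) (k : 'I_(d i)) : R[i] :=
  let nrm := Num.sqrt (\sum_(k' : 'I_(d i))
        (g (Tagged (fun j => 'I_(d j)) k', false) ^+ 2
         + g (Tagged (fun j => 'I_(d j)) k', true) ^+ 2)) in
  Complex (g (Tagged (fun j => 'I_(d j)) k, false) / nrm)
          (g (Tagged (fun j => 'I_(d j)) k, true) / nrm).

Definition sep_state (R : rcfType) (n : nat) (d : 'I_n -> nat)
  (g : key d -> R) : state R d :=
  fun x => \prod_(i < n) local_state g (x i).

Definition eps (R : realType) (n : nat) (d : 'I_n -> nat) (p : {set 'I_n})
  (U : idx d -> idx d -> R[i]) : \bar R :=
  gauss_avg (fun g : key d -> R => (tau p (apply_op U (sep_state g)))%:E).

Definition ubip (n : nat) : {set {set {set 'I_n}}} :=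
  [set [set p; ~: p] | p in [set p : {set 'I_n} | (p != finset.set0) && (p != [set: 'I_n])]].
Definition brep (n : nat) (P : {set {set 'I_n}}) : {set 'I_n} :=
  odflt finset.set0 [pick p in P].

Definition eps1 (R : realType) (n : nat) (d : 'I_n -> nat)
  (U : idx d -> idx d -> R[i]) : \bar R :=
  ((((2 : R) ^+ n.-1 - 1)^-1)%:E * \sum_(P in ubip n) eps (brep P) U)%E.

Definition dprod (n : nat) (d : 'I_n -> nat) (S : {set 'I_n}) : nat :=
  (\prod_(i in S) d i)%N.

(** the bound tilde-epsilon_{p|q}; x' ranges over all subsets of {1',..,n'}
    (ordered bipartitions x'|y', y' = ~: x') *)
Definition eps_tilde (R : realType) (n : nat) (d : 'I_n -> nat)
  (p : {set 'I_n}) : R :=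
  2 - 2 * (\prod_(i < n) ((d i)%:R / (d i).+1%:R))
          * (2 ^+ n - \sum_(x' : {set 'I_n})
               let m := minn (dprod d p * dprod d x')%N
                             (dprod d (~: p) * dprod d (~: x'))%N in
               (m%:R - 1) / m%:R).

Definition eps1_tilde (R : realType) (n : nat) (d : 'I_n -> nat) : R :=
  ((2 : R) ^+ n.-1 - 1)^-1 * \sum_(P in ubip n) eps_tilde R d (brep P).

(* Main.v *)
(** Averaging psi (x) psi over Haar-random local states replaces, for each party
    i, the projector by (1 + SWAP_i) / (d_i (d_i + 1)).  Expanding the product over
    the parties, the mean purity of U psi across p|q is the product of the
    1 / (d_i (d_i + 1)) times a sum over subsets X of the parties of the unnormalised
    purity of U, regarded as a vector of H (x) H', across the bipartition
    (p, X) | (~p, ~X); by Cauchy-Schwarz each of these is at least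
    D^2 / min (d_(p,X), d_(~p,~X)) with D = dim H.

    The Gaussian averages are reduced to an integral over a probability measure on
    the space of environments that is invariant under every planar rotation of two
    coordinates (a rotation is a product of three shears).  This symmetry alone
    gives the moments of order four of a normalised Gaussian vector: the phase
    rotation by 'i kills the unmatched moments, rotating two basis vectors gives
    E|u_a|^4 = 2 E|u_a|^2|u_b|^2, and the normalisation fixes the constant. *)
Require Import Defs.
From HB Require Import structures.
From mathcomp Require Import all_boot all_order all_algebra.
From mathcomp Require Import all_classical all_reals all_analysis.
From mathcomp Require Import measurable_realfun.
From mathcomp.real_closed Require Import complex.
From mathcomp Require Import ring lra.
Import Order.TTheory GRing.Theory Num.Theory.
Import numFieldNormedType.Exports.
Local Open Scope ring_scope.
Set Implicit Arguments. Unset Strict Implicit. Unset Printing Implicit Defensive.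

(** * Rotation invariance of planar Lebesgue integrals, and the Gaussian weight *)

Section Translation.
Context (R : realType).
Local Notation mu := (@lebesgue_measure R).
Local Open Scope classical_set_scope.

(** Lebesgue measure is determined by its values on half-open intervals, and translating an interval
    keeps its length. *)
Lemma lebesgue_measure_shift (a : R) (A : set R) : measurable A ->
  pushforward mu ((fun x => x + a) : R -> measurableTypeR R) A = mu A.
Proof.
move=> mA.
have mf : measurable_fun setT ((fun x => x + a) : R -> measurableTypeR R).
  exact: measurable_funD.
apply/esym/lebesgue_measure_unique => //=.
move=> _ [[x y]] _ <-.
rewrite /pushforward (_ : _ @^-1` _ = `]x - a, y - a]%classic); last first.
  by apply/seteqP; split=> z /=; rewrite !in_itv/= ltrBlDr lerBrDr.
rewrite !lebesgue_measure_itv/= !lte_fin ltrD2r.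
by case: ifP => // _; rewrite -!EFinD; congr (_%:E); ring.
Qed.

Lemma ge0_integral_shift (a : R) (f : R -> \bar R) :
  measurable_fun setT f -> (forall x, 0 <= f x)%E ->
  (\int[mu]_x f (x + a)%R = \int[mu]_x f x)%E.
Proof.
move=> mf f0.
have mphi : measurable_fun setT ((fun x => x + a)%R : R -> measurableTypeR R).
  exact: measurable_funD.
transitivity (\int[pushforward mu ((fun x => x + a)%R : R -> measurableTypeR R)]_x f x)%E.
  by rewrite ge0_integral_pushforward.
apply: eq_measure_integral => A mA _; exact: (lebesgue_measure_shift a mA).

Qed.

Lemma ge0_integral_shear (t : R) (f : R * R -> \bar R) :
  measurable_fun setT f -> (forall x, 0 <= f x)%E ->
  (\int[mu]_x \int[mu]_y f (x, (y + t * x)%R) = \int[mu]_x \int[mu]_y f (x, y))%E.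
Proof.
move=> mf f0; apply: eq_integral => x _.
rewrite (ge0_integral_shift (t * x) (f := fun y => f (x, y)))//.
exact: measurable_fun_pair2.
Qed.

Lemma measurable_shear (t : R) :
  measurable_fun setT (fun z : R * R => (z.1, z.2 + t * z.1)).
Proof.
apply: measurable_fun_pair; first exact: measurable_fst.
apply: measurable_funD; first exact: measurable_snd.
by apply: measurable_funM; [exact: measurable_cst|exact: measurable_fst].
Qed.

(** A rotation is a shear in the first coordinate, one in the second, and the first one again. The
    condition [1 + c != 0] excludes the half-turn, where the shear parameter would be infinite. *)
Lemma ge0_integral_rotation (c s : R) (f : R * R -> \bar R) :
  c ^+ 2 + s ^+ 2 = 1 -> 1 + c != 0 ->
  measurable_fun setT f -> (forall x, 0 <= f x)%E ->
  (\int[mu]_x \int[mu]_y f (c * x - s * y, s * x + c * y)%R =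
   \int[mu]_x \int[mu]_y f (x, y))%E.
Proof.
move=> cs1 c1 mf f0.
(* The tangent of half the rotation angle. *)
pose t := s / (1 + c).
have stc : 1 - s * t = c.
  by rewrite /t mulrA -expr2 -(addKr (c ^+ 2) (s ^+ 2)) cs1; field.
pose J g := (\int[mu]_x \int[mu]_y g (x, y))%E.
pose X g (z : R * R) : \bar R := g (z.1 - t * z.2, z.2).
pose Y g (z : R * R) : \bar R := g (z.1, z.2 + s * z.1).
pose ok (g : R * R -> \bar R) := measurable_fun setT g /\ forall z, (0 <= g z)%E.
have mX g : ok g -> ok (X g).
  move=> [mg g0]; split=> [|z]; last exact: g0.
  apply: measurableT_comp mg _; apply: measurable_fun_pair; last exact: measurable_snd.
  apply: measurable_funB; first exact: measurable_fst.
  by apply: measurable_funM; [exact: measurable_cst|exact: measurable_snd].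
have mY g : ok g -> ok (Y g).
  move=> [mg g0]; split=> [|z]; last exact: g0.
  exact: measurableT_comp mg (measurable_shear s).
(* Tonelli turns a shear in the first coordinate into one in the second. *)
have swapJ g : ok g -> J g = (\int[mu]_y \int[mu]_x g (x, y))%E.
  by move=> [mg g0]; exact: (@fubini_tonelli _ _ _ _ _ mu mu g mg g0).
have JX g : ok g -> J (X g) = J g.
  move=> og; rewrite (swapJ _ (mX _ og)) (swapJ _ og); move: og => [mg g0].
  have mgs : measurable_fun setT (g \o unstable.swap).
    by apply: measurableT_comp mg _; exact: measurable_swap.
  apply: etrans (ge0_integral_shear (- t) mgs (fun z => g0 _)).
  apply: eq_integral => y _; apply: eq_integral => x _.
  by rewrite /X/= mulNr.
have JY g : ok g -> J (Y g) = J g.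
  by move=> [mg g0]; exact: ge0_integral_shear.
have of_ : ok f by [].
rewrite -/(J f); transitivity (J (X (Y (X f)))); last first.
  by rewrite JX; [rewrite JY; [exact: JX|exact: mX]|exact/mY/mX].
apply: eq_integral => x _; apply: eq_integral => y _.
rewrite /X /Y /=; congr (f (_, _)).
  have -> : s * y = t * (1 + c) * y by rewrite /t divfK.
  by rewrite -stc; ring.
by rewrite -stc; ring.
Qed.
End Translation.

Section GaussMeasure.
Context (R : realType).
Local Notation mu := (@lebesgue_measure R).
Local Open Scope classical_set_scope.

Definition gauss_density (t : R) : R := expR (- t ^+ 2) / Num.sqrt pi.

(* exp(-t^2)/sqrt pi is the density of the normal law of variance 1/2. *)
Definition gauss := normal_prob (0 : R) (Num.sqrt 2^-1).

Lemma gauss_densityE t : gauss_density t = normal_pdf 0 (Num.sqrt 2^-1) t.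
Proof.
have s0 : Num.sqrt (2^-1 : R) != 0 by rewrite gt_eqF// sqrtr_gt0 invr_gt0.
rewrite normal_pdfE// /normal_peak /normal_fun /gauss_density subr0 sqr_sqrtr ?invr_ge0//.
rewrite mulrC; congr (_ * expR _); last first.
  by rewrite -mulr_natr mulVf ?pnatr_eq0// divr1.
by congr ((Num.sqrt _)^-1); rewrite -mulr_natr mulrAC mulVf ?pnatr_eq0// mul1r.
Qed.

Lemma measurable_gauss_density : measurable_fun setT gauss_density.
Proof.
rewrite (_ : gauss_density = normal_pdf 0 (Num.sqrt 2^-1)); first exact: measurable_normal_pdf.
by apply/funext => t; rewrite gauss_densityE.
Qed.

Lemma gauss_density_ge0 t : 0 <= gauss_density t.
Proof. by rewrite gauss_densityE normal_pdf_ge0. Qed.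

(** The Radon-Nikodym derivative of the normal law agrees almost everywhere with the density,
    because both have the same integral over every measurable set. *)
Lemma gauss_integralE (f : R -> \bar R) :
  (gauss : {measure set _ -> \bar R}).-integrable setT f ->
  (\int[gauss]_x f x = \int[mu]_x ((gauss_density x)%:E * f x))%E.
Proof.
move=> intf; have dom := @normal_prob_dominates R 0 (Num.sqrt 2^-1).
rewrite -(Radon_Nikodym_change_of_variables dom)//=.
under [RHS]eq_integral do rewrite gauss_densityE muleC.
have mf : measurable_fun setT f := measurable_int _ intf.
apply: ae_eq_integral => //.
- apply: emeasurable_funM => //; apply: (measurable_int mu).
- apply: emeasurable_funM => //; apply/measurable_EFinP.
  exact: measurable_normal_pdf.
- apply: ae_eqe_mul2l => /=.
  rewrite Radon_NikodymE//=.
  case: cid => /= h [h1 h2 h3].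
  apply: integral_ae_eq => //=.
  + by apply/measurable_EFinP; exact: measurable_normal_pdf.
  + by move=> E _ mE; rewrite -h3.
Qed.

End GaussMeasure.

(** * The law of the Gaussian environment *)

Section BoundedMeasurable.
Context d (T : measurableType d) (R : realType).
Implicit Types f g : T -> R.
Local Open Scope classical_set_scope.

(** A class closed under the ring operations and integrable for every probability, so that
    integrability conditions are discharged uniformly. *)
Definition bounded_mfun f := measurable_fun setT f /\ exists C, forall x, `|f x| <= C.

Lemma bounded_mfun_integrable (P : probability T R) f : bounded_mfun f ->
  P.-integrable setT (EFin \o f).
Proof.
move=> [mf [C fC]]; apply: measurable_bounded_integrable => //.
  by rewrite (le_lt_trans (probability_le1 _ _))// ltry.
exists C; split; first exact: num_real.
by move=> M CM x _; exact: (le_trans (fC x) (ltW CM)).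
Qed.

Lemma bounded_mfun_cst r : bounded_mfun (fun _ => r).
Proof. by split; [exact: measurable_cst|exists `|r|]. Qed.

Lemma bounded_mfunD f g : bounded_mfun f -> bounded_mfun g -> bounded_mfun (fun x => f x + g x).
Proof.
move=> [mf [C fC]] [mg [D gD]]; split; first exact: measurable_funD.
by exists (C + D) => x; rewrite (le_trans (ler_normD _ _))// lerD.
Qed.

Lemma bounded_mfunM f g : bounded_mfun f -> bounded_mfun g -> bounded_mfun (fun x => f x * g x).
Proof.
move=> [mf [C fC]] [mg [D gD]]; split; first exact: measurable_funM.
by exists (C * D) => x; rewrite normrM ler_pM.
Qed.

Lemma bounded_mfunN f : bounded_mfun f -> bounded_mfun (fun x => - f x).
Proof.
move=> [mf [C fC]]; split; first exact: measurableT_comp.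
by exists C => x; rewrite normrN.
Qed.

Lemma bounded_mfunB f g : bounded_mfun f -> bounded_mfun g -> bounded_mfun (fun x => f x - g x).
Proof. by move=> bf bg; apply: bounded_mfunD => //; exact: bounded_mfunN. Qed.

Lemma bounded_mfun_indic (A : set T) : measurable A -> bounded_mfun (\1_A).
Proof.
move=> mA; split; first exact: measurable_indic.
by exists 1 => x; rewrite indicE; case: (_ \in _); rewrite /= ?normr1 ?normr0 ?ler01.
Qed.

End BoundedMeasurable.

Lemma bounded_mfun_comp d d' (T : measurableType d) (T' : measurableType d') (R : realType)
  (f : T' -> R) (h : T -> T') : bounded_mfun f -> measurable_fun setT h -> bounded_mfun (fun x
    => f (h x)).
Proof.
move=> [mf [C fC]] mh; split; first exact: measurableT_comp.
by exists C.
Qed.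

Section EnvSpace.
Context (R : realType) (K : eqType).
Local Open Scope classical_set_scope.

(** Generators of the product sigma-algebra. *)
Definition cylinders : set (set (K -> R)) :=
  [set A | exists k, exists2 B : set R, measurable B & (fun e => e k) @^-1` B = A].

Definition env := g_sigma_algebraType cylinders.

Lemma measurable_coord k : measurable_fun setT (fun e : env => e k : R).
Proof.
move=> _ B mB; rewrite setTI; apply: sub_sigma_algebra.
by exists k, B.
Qed.

Lemma measurable_env d (T : measurableType d) (f : T -> env) :
  (forall k, measurable_fun setT (fun x => f x k : R)) -> measurable_fun setT f.
Proof.
move=> mf; apply: (@measurability _ _ T env setT f cylinders) => //.
move=> _ [_ [k [B mB <-]] <-].
exact: mf.
Qed.

Definition upd (k : K) (t : R) (e : K -> R) : env := fun j => if j == k then t else e j.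
Definition merge (s : seq K) (e e0 : K -> R) : env := fun j => if j \in s then e j else e0 j.

Lemma merge_upd k s t (e e0 : env) : k \notin s ->
  merge (k :: s) (upd k t e) e0 = merge s e (upd k t e0).
Proof.
move=> ks; apply/funext => j; rewrite /merge /upd in_cons.
by case: eqVneq => [->|//]; rewrite (negbTE ks).
Qed.

Lemma measurable_upd k :
  measurable_fun setT (fun z : measurableTypeR R * env => upd k z.1 z.2).
Proof.
apply: measurable_env => j; rewrite /upd; case: eqP => _.
  exact: measurable_fst.
by apply: (measurableT_comp (measurable_coord j)); exact: measurable_snd.
Qed.

Lemma measurable_merge_upd k s (e0 : env) :
  measurable_fun setT (fun z : measurableTypeR R * env => merge s z.2 (upd k z.1 e0)).
Proof.
apply: measurable_env => j; rewrite /merge /upd; case: (j \in s).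
  by apply: (measurableT_comp (measurable_coord j)); exact: measurable_snd.
case: (j == k); first exact: measurable_fst.
exact: measurable_cst.
Qed.

Lemma measurable_merge s :
  measurable_fun setT (fun z : env * env => merge s z.2 z.1).
Proof.
apply: measurable_env => j; rewrite /merge; case: (j \in s).
  by apply: (measurableT_comp (measurable_coord j)); exact: measurable_snd.
by apply: (measurableT_comp (measurable_coord j)); exact: measurable_fst.
Qed.

(** Turns the iterated integral into one integral over a probability that serves all [F] and [e0] at
    once. By induction, the probability for [k :: s] is the image of [gauss] times that for [s]
    under [upd k]; Fubini concludes. *)
Lemma gint_rep s : uniq s -> exists P : probability env R,
  forall F : env -> R, bounded_mfun F -> forall e0 : env,
  gint s (fun e => (F e)%:E) e0 = (\int[P]_e (F (merge s e e0))%:E)%E.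
Proof.
elim: s => [_|k s IH /= /andP[ks us]].
  (* With no coordinate integrated, [merge] ignores [e], so any probability would do. *)
  exists (\d_ (point : env)) => F bF e0 /=.
  transitivity (\int[\d_ (point : env)]_(e in setT) (cst (F e0)%:E) e)%E; last by [].
  by rewrite integral_cst//= /dirac indicT mule1.
have [P PE] := IH us.
pose phi := fun z : measurableTypeR R * env => upd k z.1 z.2.
have mphi : measurable_fun setT phi := measurable_upd k.
pose phim := mfun_Sub (mem_set mphi).
exists (distribution (@gauss R \x P)%E phim) => F bF e0.
have bG : bounded_mfun (fun z : measurableTypeR R * env => F (merge s z.2 (upd k z.1 e0))).
  by apply: bounded_mfun_comp bF _; exact: measurable_merge_upd.
have iG := bounded_mfun_integrable (@gauss R \x P)%E bG.
have bF' : bounded_mfun (fun e : env => F (merge (k :: s) e e0)).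
  apply: bounded_mfun_comp bF _; apply: measurable_env => j; rewrite /merge.
  by case: (j \in _); [exact: measurable_coord|exact: measurable_cst].
rewrite integral_distribution; last 2 first.
- by apply/measurable_EFinP; case: bF'.
- by apply: (bounded_mfun_integrable _ (bounded_mfun_comp bF' mphi)).
transitivity (\int[@gauss R \x P]_z (F (merge s z.2 (upd k z.1 e0)))%:E)%E; last first.
  by apply: eq_integral => -[t e] _ /=; rewrite merge_upd.
rewrite -integral12_prod_meas1//.
rewrite gauss_integralE; last exact: integrable_fubini_F.
apply: eq_integral => t _; congr (_ * _)%E.
exact: (PE F bF (upd k t e0)).
Qed.

End EnvSpace.

Lemma le_Rintegral_bound d (T : measurableType d) (R : realType) (P : probability T R)
  (f : T -> R) (C : R) : measurable_fun setT f -> (forall x, `|f x| <= C) ->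
  `|(\int[P]_x f x)%R| <= C.
Proof.
move=> mf fC; have bf : bounded_mfun f by split => //; exists C.
have bn : bounded_mfun (fun x => `|f x|).
  by split; [exact: measurableT_comp|exists C => x; rewrite normr_id].
apply: le_trans (le_normr_Rintegral _ (bounded_mfun_integrable P bf)) _ => //.
have := le_Rintegral measurableT (bounded_mfun_integrable P bn) (bounded_mfun_integrable P
  (bounded_mfun_cst T C)) (fun x _ => fC x).
by rewrite Rintegral_cst//= [P _]probability_setT mulr1.
Qed.

(** * Exchange of variables and rotation invariance for iterated Gaussian integrals *)

Section GintTheory.
Context (R : realType) (K : eqType).
Local Notation mu := (@lebesgue_measure R).
Local Notation env := (env R K).
Implicit Types (F : env -> R) (s : seq K).

(** Keeps the inner integrals within bounded measurable functions of the outer coordinates, so that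
    one or two outer integrals can be studied alone. *)
Lemma gint_bmf s F : uniq s -> bounded_mfun F -> exists G : env -> R,
  [/\ bounded_mfun G, (forall e, 0 <= F e) -> forall e, 0 <= G e &
      forall e0 : env, gint s (fun e => (F e)%:E) e0 = (G e0)%:E].
Proof.
move=> us bF; have [P PE] := gint_rep R us.
have bF' : bounded_mfun (fun z : env * env => F (merge s z.2 z.1)).
  by apply: bounded_mfun_comp bF _; exact: measurable_merge.
exists (fun e0 => \int[P]_e F (merge s e e0))%R; split.
- split.
    apply: (measurableT_comp (@fine_measurable R setT measurableT)).
    exact: (measurable_fubini_F (bounded_mfun_integrable (P \x P)%E bF')).
  case: bF' => mF' [C FC]; exists C => e0; apply: le_Rintegral_bound.
    exact: (measurable_fun_pair2 _ mF').
  by move=> e; exact: (FC (e0, e)).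
- by move=> F0 e; apply: Rintegral_ge0.
- move=> e0; rewrite (PE F bF e0) fineK//.
  apply: integrable_fin_num => //; apply: bounded_mfun_integrable.
  apply: (@bounded_mfun_comp _ _ _ _ _ _ (fun e => (e0, e)) bF').
  exact: pair1_measurable.
Qed.

Lemma gint_cons_bmf k (G : env -> R) (e0 : env) : bounded_mfun G ->
  (\int[mu]_t ((gauss_density t)%:E * (G (upd k t e0))%:E) =
   \int[@gauss R]_t (G (upd k t e0))%:E)%E.
Proof.
move=> bG.
have bG1 : bounded_mfun (fun t : measurableTypeR R => G (upd k t e0)).
  apply: bounded_mfun_comp bG _; apply: measurable_env => j; rewrite /upd.
  by case: (j == k); [exact: measurable_id|exact: measurable_cst].
by rewrite gauss_integralE//; exact: (bounded_mfun_integrable (@gauss R) bG1).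
Qed.

Lemma measurable_upd2 k l (e0 : env) :
  measurable_fun setT (fun z : measurableTypeR R * measurableTypeR R => upd l z.2 (upd k z.1 e0)).
Proof.
apply: measurable_env => j; rewrite /upd; case: (j == l); first exact: measurable_snd.
by case: (j == k); [exact: measurable_fst|exact: measurable_cst].
Qed.

Lemma gint_cons2 k l s F (G : env -> R) (e0 : env) : bounded_mfun G ->
  (forall e0 : env, gint s (fun e => (F e)%:E) e0 = (G e0)%:E) ->
  gint (k :: l :: s) (fun e => (F e)%:E) e0 =
  (\int[@gauss R]_t \int[@gauss R]_u (G (upd l u (upd k t e0)))%:E)%E.
Proof.
move=> bG GE.
have bG2 : bounded_mfun (fun z : measurableTypeR R * measurableTypeR R => G (upd l z.2 (upd k
  z.1 e0))).
  by apply: bounded_mfun_comp bG _; exact: measurable_upd2.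
rewrite gauss_integralE; last first.
  exact: (integrable_fubini_F (bounded_mfun_integrable (@gauss R \x @gauss R)%E bG2)).
apply: eq_integral => t _; congr (_ * _)%E.
rewrite -(gint_cons_bmf l (upd k t e0) bG).
by apply: eq_integral => u _; congr (_ * _)%E; exact: GE.
Qed.

Lemma updC k l t u (e : env) : k != l -> upd l u (upd k t e) = upd k t (upd l u e).
Proof.
move=> kl; apply/funext => j; rewrite /upd.
by case: (eqVneq j l) => [->|//]; rewrite eq_sym (negbTE kl).
Qed.

(** Fubini for the two outer integrals, together with the fact that updates at distinct keys
    commute. *)
Lemma gint_swap k l s F (e0 : env) : uniq (k :: l :: s) -> bounded_mfun F ->
  gint (k :: l :: s) (fun e => (F e)%:E) e0 = gint (l :: k :: s) (fun e => (F e)%:E) e0.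
Proof.
move=> ukl bF; have [+ /andP[ls us]] := andP ukl; rewrite inE negb_or => /andP[kl ks].
have [G [bG _ GE]] := gint_bmf us bF.
rewrite !(gint_cons2 _ _ _ bG GE).
have bG2 : bounded_mfun (fun z : measurableTypeR R * measurableTypeR R => G (upd l z.2 (upd k
  z.1 e0))).
  by apply: bounded_mfun_comp bG _; exact: measurable_upd2.
rewrite (Fubini (bounded_mfun_integrable (@gauss R \x @gauss R)%E bG2)).
by apply: eq_integral => u _; apply: eq_integral => t _; rewrite /= updC.
Qed.

(** Adjacent exchanges bring any key outermost; the order of enumeration thus does not matter. *)
Lemma gint_front k s F (e0 : env) : uniq s -> k \in s -> bounded_mfun F ->
  gint s (fun e => (F e)%:E) e0 = gint (k :: rem k s) (fun e => (F e)%:E) e0.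
Proof.
elim: s e0 => // j s IH e0 /= /andP[js us]; rewrite in_cons eq_sym.
case: (eqVneq j k) => [->//|jk /= ks bF].
rewrite -[RHS](gint_swap (k := j) (l := k) (s := rem k s) e0 _ bF); last first.
  by rewrite /= inE negb_or jk rem_uniq// mem_rem_uniqF// (contra (@mem_rem _ _ _ _)).
by apply: eq_integral => t _; congr (_ * _)%E; exact: IH.
Qed.

(** The integrand is constant on the environments that are merged with [e0], and the total mass is
    one. *)
Lemma gint_indep s F (e0 : env) : uniq s -> bounded_mfun F ->
  (forall e e' : env, (forall j, j \notin s -> e j = e' j) -> F e = F e') ->
  gint s (fun e => (F e)%:E) e0 = (F e0)%:E.
Proof.
move=> us bF Fs; have [P PE] := gint_rep R us; rewrite (PE F bF e0).
rewrite (eq_integral (cst (F e0)%:E)); last first.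
  move=> e _ /=; congr (_%:E); apply: Fs => j js.
  by rewrite /merge (negbTE js).
by rewrite integral_cst//= [P _]probability_setT mule1.
Qed.

Definition rot (k l : K) (c r : R) (e : K -> R) : env :=
  fun j => if j == k then c * e k - r * e l else if j == l then r * e k + c * e l else e j.

Lemma measurable_rot k l c r : measurable_fun setT (rot k l c r : env -> env).
Proof.
apply: measurable_env => j; rewrite /rot; case: (j == k).
  by apply: measurable_funB; apply: measurable_funM => //; exact: measurable_coord.
case: (j == l); last exact: measurable_coord.
by apply: measurable_funD; apply: measurable_funM => //; exact: measurable_coord.
Qed.

(** A rotation in the plane of [k] and [l] commutes with updates at all other keys, so it passes
    down to the initial environment. *)
Lemma gint_rot k l c r s (F : (K -> R) -> \bar R) (e0 : env) : k \notin s -> l \notin s ->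
  gint s (fun e => F (rot k l c r e)) e0 = gint s F (rot k l c r e0).
Proof.
elim: s e0 => //= j s IH e0; rewrite !in_cons !negb_or => /andP[kj ks] /andP[lj ls].
apply: eq_integral => t _; congr (_ * _)%E; rewrite IH//; congr gint.
apply/funext => i; rewrite /rot; have [->|ij] := eqVneq i j.
  by rewrite eq_sym (negbTE kj) eq_sym (negbTE lj).
by rewrite (negbTE kj) (negbTE lj).
Qed.

(** The weight of the two outer variables depends only on [t ^+ 2 + u ^+ 2], so weight and integrand
    rotate together and the invariance of planar Lebesgue integrals applies. *)
Lemma gint_rotation k l c r s F (e0 : env) : uniq (k :: l :: s) -> bounded_mfun F ->
  (forall e, 0 <= F e) -> c ^+ 2 + r ^+ 2 = 1 -> 1 + c != 0 ->
  gint (k :: l :: s) (fun e => (F (rot k l c r e))%:E) e0 =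
  gint (k :: l :: s) (fun e => (F e)%:E) e0.
Proof.
move=> ukl bF F0 cr1 c1; have [+ /andP[ls us]] := andP ukl; rewrite inE negb_or => /andP[kl ks].
have [G [bG G0 GE]] := gint_bmf us bF.
(* The whole planar integrand, both weights included, once the variables in [s] are integrated
   out. *)
pose W z := ((gauss_density z.1)%:E * ((gauss_density z.2)%:E * (G (upd l z.2 (upd k z.1
  e0)))%:E))%E.
have W0 z : (0 <= W z)%E.
  by rewrite /W !mule_ge0 ?lee_fin ?gauss_density_ge0 ?G0.
have mg1 : measurable_fun setT (fun z : measurableTypeR R * measurableTypeR R => gauss_density z.1).
  by apply: (measurableT_comp (@measurable_gauss_density R)); exact: measurable_fst.
have mg2 : measurable_fun setT (fun z : measurableTypeR R * measurableTypeR R => gauss_density z.2).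
  by apply: (measurableT_comp (@measurable_gauss_density R)); exact: measurable_snd.
have [mG _] := bounded_mfun_comp bG (measurable_upd2 k l e0).
have mW : measurable_fun setT W.
  by apply: emeasurable_funM; [|apply: emeasurable_funM]; apply/measurable_EFinP.
have mGt t : measurable_fun setT (fun u => (gauss_density u)%:E * (G (upd l u (upd k t e0)))%:E)%E.
  apply: emeasurable_funM; apply/measurable_EFinP; first exact: measurable_gauss_density.
  exact: (measurable_fun_pair2 t mG).
transitivity (\int[mu]_t \int[mu]_u W (t, u))%E; last first.
  apply: eq_integral => t _; rewrite /W /= ge0_integralZl//.
  - by congr (_ * _)%E; apply: eq_integral => u _; congr (_ * _)%E; exact/esym/GE.
  - exact: mGt.
  - by move=> u _; rewrite mule_ge0 ?lee_fin ?gauss_density_ge0 ?G0.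
  - by rewrite lee_fin gauss_density_ge0.
have mWr : measurable_fun setT (fun z : measurableTypeR R * measurableTypeR R =>
    W (c * z.1 - r * z.2, r * z.1 + c * z.2)).
  apply: measurableT_comp mW _; apply: measurable_fun_pair.
    by apply: measurable_funB; apply: measurable_funM.
  by apply: measurable_funD; apply: measurable_funM.
rewrite -(ge0_integral_rotation cr1 c1 mW W0).
apply: eq_integral => t _.
transitivity (\int[mu]_u ((gauss_density t)%:E * ((gauss_density u)%:E *
    (G (upd l (r * t + c * u) (upd k (c * t - r * u) e0)))%:E)))%E; last first.
  apply: eq_integral => u _; rewrite /W /= !muleA; congr (_ * _)%E.
  rewrite -!EFinM; congr (_%:E); rewrite /gauss_density mulrACA [in RHS]mulrACA -!expRD.
  congr (expR _ * _); rewrite -!opprD; congr (- _).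
  transitivity ((c ^+ 2 + r ^+ 2) * (t ^+ 2 + u ^+ 2)); last by ring.
  by rewrite cr1 mul1r.
rewrite ge0_integralZl//; last 3 first.
- apply: emeasurable_funM; apply/measurable_EFinP; first exact: measurable_gauss_density.
  apply: (measurableT_comp mG (g := fun u => (c * t - r * u, r * t + c * u))).
  apply: measurable_fun_pair.
    by apply: measurable_funB => //; apply: measurable_funM.
  by apply: measurable_funD => //; apply: measurable_funM.
- by move=> u _; rewrite mule_ge0 ?lee_fin ?gauss_density_ge0 ?G0.
- by rewrite lee_fin gauss_density_ge0.
congr (_ * _)%E; apply: eq_integral => u _; congr (_ * _)%E.
transitivity (gint s (fun e => (F e)%:E) (rot k l c r (upd l u (upd k t e0)))).
  exact: (gint_rot c r (fun e => (F e)%:E) (upd l u (upd k t e0)) ks ls).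
rewrite GE; congr (G _)%:E.
apply/funext => j; rewrite /rot /upd !eqxx (negbTE kl).
case: (eqVneq j k) => [->|jk]; first by rewrite (negbTE kl).
by case: (eqVneq j l).
Qed.

End GintTheory.

(** * The joint law of all Gaussian coordinates and its symmetries *)

Section EnvLaw.
Context (R : realType) (K : finType).
Local Notation env := (env R K).
Local Open Scope classical_set_scope.

Definition env_law : probability env R := sval (cid (gint_rep R (enum_uniq K))).

Lemma gauss_avgE (F : env -> R) : bounded_mfun F ->
  gauss_avg (fun e => (F e)%:E) = (\int[env_law]_e (F e)%:E)%E.
Proof.
move=> bF; rewrite /gauss_avg /env_law; case: cid => P PE /=.
rewrite (PE F bF (fun=> 0)); apply: eq_integral => e _; congr (F _)%:E.
by apply/funext => j; rewrite /merge mem_enum.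
Qed.

Lemma env_lawE (A : set env) : measurable A ->
  env_law A = gauss_avg (fun e => (\1_A e)%:E).
Proof.
move=> mA; rewrite (gauss_avgE (bounded_mfun_indic R mA)) integral_indic//.
by rewrite setIT.
Qed.

(** [gint_rotation] needs a non-negative integrand. It is applied to indicators, which makes the
    measure itself invariant; the change of variables then covers bounded [F] of any sign. *)
Lemma env_law_rot (k l : K) c r (F : env -> R) : k != l -> c ^+ 2 + r ^+ 2 = 1 ->
  1 + c != 0 -> bounded_mfun F ->
  (\int[env_law]_e F (rot k l c r e) = \int[env_law]_e F e)%R.
Proof.
move=> kl cr1 c1 bF.
have mrot : measurable_fun setT (rot k l c r : env -> env) := measurable_rot k l c r.
have inv (A : set env) : measurable A -> env_law ((rot k l c r : env -> env) @^-1` A) = env_law A.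
  move=> mA.
  have mA' : measurable ((rot k l c r : env -> env) @^-1` A).
    by rewrite -[X in measurable X]setTI; exact: mrot.
  rewrite !env_lawE// /gauss_avg.
  (* Both rotated coordinates are made the two outermost ones. *)
  have front (G : env -> R) : bounded_mfun G ->
      gint (enum K) (fun e => (G e)%:E) (fun=> 0) =
      gint (k :: l :: rem l (rem k (enum K))) (fun e => (G e)%:E) (fun=> 0).
    move=> bG; rewrite (gint_front (k := k) (fun=> 0))// ?enum_uniq ?mem_enum//.
    apply: eq_integral => t _; congr (_ * _)%E.
    by apply: gint_front; rewrite ?rem_uniq ?enum_uniq ?mem_rem_uniq ?enum_uniq//
      inE mem_enum eq_sym kl.
  have bA := bounded_mfun_indic R mA.
  have ukl : uniq (k :: l :: rem l (rem k (enum K))).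
    by rewrite /= inE negb_or kl !mem_rem_uniqF ?rem_uniq ?enum_uniq// andbT/=
      (contra (@mem_rem _ _ _ _)) ?mem_rem_uniqF ?enum_uniq.
  have A0 e : 0 <= \1_A e :> R by [].
  rewrite (front _ bA) (front _ (bounded_mfun_indic R mA')).
  exact: (gint_rotation (fun=> 0) ukl bA A0 cr1 c1).
congr fine.
transitivity (\int[pushforward env_law (rot k l c r : env -> env)]_e (F e)%:E)%E.
  rewrite integral_pushforward//; first by apply/measurable_EFinP; case: bF.
  exact: (bounded_mfun_integrable env_law (bounded_mfun_comp bF mrot)).
by apply: eq_measure_integral => A mA _; exact: inv.
Qed.

(** With [k] outermost the other integrals leave the indicator unchanged, and a single point is null
    for the normal law. *)
Lemma env_law_coord0 (k : K) : env_law [set e | e k = 0] = 0%E.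
Proof.
pose s := rem k (enum K).
have us : uniq s by rewrite rem_uniq ?enum_uniq.
have ks : k \notin s by rewrite mem_rem_uniqF ?enum_uniq.
have mA : measurable [set e : env | e k = 0].
  rewrite -[X in measurable X]setTI.
  exact: (measurable_coord k measurableT (measurable_set1 0)).
rewrite env_lawE// /gauss_avg.
have bA := bounded_mfun_indic R mA.
rewrite (gint_front (k := k) (fun=> 0))// ?enum_uniq ?mem_enum//.
transitivity (\int[lebesgue_measure]_t ((gauss_density t)%:E * (\1_[set e : env | e k = 0]
    (upd k t (fun=> 0)))%:E))%E.
  apply: eq_integral => t _; congr (_ * _)%E.
  apply: (gint_indep (upd k t (fun=> 0)) us bA) => e e' ee'.
  by rewrite !indicE; congr ((_ : bool)%:R); apply/idP/idP; rewrite !inE/= ee'.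
rewrite (gint_cons_bmf _ _ bA).
transitivity (\int[@gauss R]_t (\1_[set (0 : R)] t)%:E)%E.
  apply: eq_integral => t _; congr (_%:E); rewrite !indicE; congr ((_ : bool)%:R).
  by apply/idP/idP; rewrite !inE/= /upd eqxx.
rewrite integral_indic//= setIT.
by rewrite /gauss /normal_prob integral_set1.
Qed.

End EnvLaw.

(** * Complex expectations *)

Section ComplexParts.
Variable R : rcfType.
Implicit Types x y : R[i].

Lemma complexReD x y : complex.Re (x + y) = complex.Re x + complex.Re y.
Proof. by case: x y => [a b] [a' b']. Qed.
Lemma complexImD x y : complex.Im (x + y) = complex.Im x + complex.Im y.
Proof. by case: x y => [a b] [a' b']. Qed.
Lemma complexReM x y : complex.Re (x * y) = complex.Re x * complex.Re y - complex.Im x *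
  complex.Im y.
Proof. by case: x y => [a b] [a' b']. Qed.
Lemma complexImM x y : complex.Im (x * y) = complex.Re x * complex.Im y + complex.Im x *
  complex.Re y.
Proof. by case: x y => [a b] [a' b']. Qed.
Lemma complexReJ x : complex.Re x^* = complex.Re x.
Proof. by case: x. Qed.
Lemma complexImJ x : complex.Im x^* = - complex.Im x.
Proof. by case: x. Qed.
Lemma complex_ext x y : complex.Re x = complex.Re y -> complex.Im x = complex.Im y -> x = y.
Proof. by case: x y => [a b] [a' b'] /= -> ->. Qed.

End ComplexParts.

Section ComplexExpectation.
Context d (T : measurableType d) (R : realType).
Local Notation C := (Num.RealClosedField.sort R)[i].
Implicit Types f g : T -> C.

Definition bounded_cmfun f := bounded_mfun (fun t => complex.Re (f t)) /\ bounded_mfun (fun t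
  => complex.Im (f t)).

Lemma bounded_cmfun_cst a : bounded_cmfun (fun _ => a).
Proof. by split; exact: bounded_mfun_cst. Qed.

Lemma bounded_cmfunD f g : bounded_cmfun f -> bounded_cmfun g -> bounded_cmfun (fun t => f t + g t).
Proof.
move=> [f1 f2] [g1 g2]; split.
  by under eq_fun do rewrite complexReD; exact: bounded_mfunD.
by under eq_fun do rewrite complexImD; exact: bounded_mfunD.
Qed.

Lemma bounded_cmfunM f g : bounded_cmfun f -> bounded_cmfun g -> bounded_cmfun (fun t => f t * g t).
Proof.
move=> [f1 f2] [g1 g2]; split.
  by under eq_fun do rewrite complexReM; apply: bounded_mfunB; exact: bounded_mfunM.
by under eq_fun do rewrite complexImM; apply: bounded_mfunD; exact: bounded_mfunM.
Qed.

Lemma bounded_cmfun_conj f : bounded_cmfun f -> bounded_cmfun (fun t => (f t)^*).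
Proof.
move=> [f1 f2]; split; first by under eq_fun do rewrite complexReJ.
by under eq_fun do rewrite complexImJ; exact: bounded_mfunN.
Qed.

Lemma bounded_cmfun_sum (I : Type) (r : seq I) (Q : pred I) (F : I -> T -> C) :
  (forall i, Q i -> bounded_cmfun (F i)) -> bounded_cmfun (fun t => \sum_(i <- r | Q i) F i t).
Proof.
move=> bF; elim: r => [|i r IH].
  by under eq_fun do rewrite big_nil; exact: bounded_cmfun_cst.
case Qi: (Q i); under eq_fun do rewrite big_cons Qi; last by [].
by apply: bounded_cmfunD => //; exact: bF.
Qed.

Lemma bounded_cmfun_prod (I : Type) (r : seq I) (Q : pred I) (F : I -> T -> C) :
  (forall i, Q i -> bounded_cmfun (F i)) -> bounded_cmfun (fun t => \prod_(i <- r | Q i) F i t).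
Proof.
move=> bF; elim: r => [|i r IH].
  by under eq_fun do rewrite big_nil; exact: bounded_cmfun_cst.
case Qi: (Q i); under eq_fun do rewrite big_cons Qi; last by [].
by apply: bounded_cmfunM => //; exact: bF.
Qed.

Variable P : probability T R.

Definition cmean f : C :=
  Complex (\int[P]_t complex.Re (f t))%R (\int[P]_t complex.Im (f t))%R.

Lemma cmean_cst a : cmean (fun _ => a) = a.
Proof.
by apply: complex_ext; rewrite /cmean /= Rintegral_cst//= [P _]probability_setT mulr1.
Qed.

Lemma cmeanD f g : bounded_cmfun f -> bounded_cmfun g -> cmean (fun t => f t + g t) = cmean f +
  cmean g.
Proof.
move=> [f1 f2] [g1 g2]; apply: complex_ext; rewrite /cmean ?complexReD ?complexImD /=.
  rewrite -RintegralD//; [|exact: bounded_mfun_integrable..].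
  by congr Rintegral; apply/funext => t; rewrite complexReD.
rewrite -RintegralD//; [|exact: bounded_mfun_integrable..].
by congr Rintegral; apply/funext => t; rewrite complexImD.
Qed.

Lemma cmeanZ a f : bounded_cmfun f -> cmean (fun t => a * f t) = a * cmean f.
Proof.
move=> [f1 f2]; apply: complex_ext; rewrite /cmean ?complexReM ?complexImM /=.
  rewrite -!RintegralZl//; [|exact: bounded_mfun_integrable..].
  rewrite -RintegralB//; [|exact/bounded_mfun_integrable/bounded_mfunM/f1/bounded_mfun_cst|exact/bounded_mfun_integrable/bounded_mfunM/f2/bounded_mfun_cst].
  by congr Rintegral; apply/funext => t; rewrite complexReM.
rewrite -!RintegralZl//; [|exact: bounded_mfun_integrable..].
rewrite -RintegralD//; [|exact/bounded_mfun_integrable/bounded_mfunM/f2/bounded_mfun_cst|exact/bounded_mfun_integrable/bounded_mfunM/f1/bounded_mfun_cst].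
by congr Rintegral; apply/funext => t; rewrite complexImM.
Qed.

Lemma cmean_sum (I : Type) (r : seq I) (Q : pred I) (F : I -> T -> C) :
  (forall i, Q i -> bounded_cmfun (F i)) ->
  cmean (fun t => \sum_(i <- r | Q i) F i t) = \sum_(i <- r | Q i) cmean (F i).
Proof.
move=> bF; elim: r => [|i r IH].
  by under eq_fun do rewrite big_nil; rewrite big_nil cmean_cst.
rewrite big_cons; case Qi: (Q i); under eq_fun do rewrite big_cons Qi; last by [].
by rewrite cmeanD ?IH//; [exact: bF|exact: bounded_cmfun_sum].
Qed.

Lemma cmean_ae f g (N : set T) : measurable N -> P N = 0%E -> bounded_cmfun f -> bounded_cmfun g ->
  (forall t, ~ N t -> f t = g t) -> cmean f = cmean g.
Proof.
move=> mN PN0 [f1 f2] [g1 g2] fg.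
have ae (u v : T -> R) : bounded_mfun u -> bounded_mfun v -> (forall t, ~ N t -> u t = v t) ->
    (\int[P]_t u t = \int[P]_t v t)%R.
  move=> bu bv uv; congr fine; apply: ae_eq_integral => //.
  - by apply/measurable_EFinP; case: bu.
  - by apply/measurable_EFinP; case: bv.
  exists N; split => // t /= H; apply: contrapT => Nt; apply: H => _.
  by congr (_%:E); exact: uv.
by apply: complex_ext; rewrite /cmean /=; apply: ae => // t Nt; rewrite fg.
Qed.

End ComplexExpectation.

(** * Moments of order four of a random local state *)

Section Moments.
Context (R : realType) (n : nat) (d : 'I_n -> nat).
Local Notation C := (Num.RealClosedField.sort R)[i].
Local Notation env := (env R (key d)).
Local Notation law := (env_law R (key d)).

Definition ckey (i : 'I_n) (a : 'I_(d i)) (b : bool) : key d :=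
  (Tagged (fun j => 'I_(d j)) a, b).

Lemma ckey_eq i (a a' : 'I_(d i)) b b' : (ckey a b == ckey a' b') = (a == a') && (b == b').
Proof. by rewrite /ckey xpair_eqE eq_Tagged. Qed.

Definition nrm2 (g : key d -> R) (i : 'I_n) : R :=
  \sum_(a : 'I_(d i)) (g (ckey a false) ^+ 2 + g (ckey a true) ^+ 2).

Lemma local_stateE g i (a : 'I_(d i)) : local_state g a =
  Complex (g (ckey a false) / Num.sqrt (nrm2 g i)) (g (ckey a true) / Num.sqrt (nrm2 g i)).
Proof. by []. Qed.

Lemma nrm2_ge g i (a : 'I_(d i)) b : g (ckey a b) ^+ 2 <= nrm2 g i.
Proof.
rewrite /nrm2 (bigD1 a)//=.
have h : 0 <= \sum_(a' | a' != a) (g (ckey a' false) ^+ 2 + g (ckey a' true) ^+ 2).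
  by apply: sumr_ge0 => a' _; rewrite addr_ge0 ?sqr_ge0.
have h1 := sqr_ge0 (g (ckey a false)); have h2 := sqr_ge0 (g (ckey a true)).
case: b; lra.
Qed.

Lemma nrm2_ge0 g i : 0 <= nrm2 g i.
Proof. by apply: sumr_ge0 => a _; rewrite addr_ge0 ?sqr_ge0. Qed.

(** No coordinate exceeds the norm in absolute value, so the bound is 1. *)
Lemma bounded_mfun_coord i (a : 'I_(d i)) b :
  bounded_mfun (fun g : env => g (ckey a b) / Num.sqrt (nrm2 g i)).
Proof.
have mc b' a' : measurable_fun setT (fun g : env => g (@ckey i a' b') : R).
  exact: measurable_coord.
have mn : measurable_fun setT (fun g : env => nrm2 g i).
  apply: measurable_sum => a'.
  by apply: measurable_funD; apply: measurable_funX.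
split.
  apply: measurable_funM => //.
  (* The inverse square root becomes a real power, for which measurability is available. *)
  rewrite (_ : (fun _ => _) = (fun g : env => nrm2 g i `^ (- 2^-1))); last first.
    by apply/funext => g; rewrite powRN powR12_sqrt// nrm2_ge0.
  exact: (measurableT_comp (measurable_powR (- 2^-1)) mn).
exists 1 => g; rewrite normrM normfV (ger0_norm (sqrtr_ge0 _)).
(* For the zero vector the quotient is 0, since [x / 0 = 0]. *)
have [->|s0] := eqVneq (Num.sqrt (nrm2 g i)) 0; first by rewrite invr0 mulr0.
rewrite ler_pdivrMr ?lt_def ?s0 ?sqrtr_ge0// mul1r -sqrtr_sqr ler_wsqrtr//.
exact: nrm2_ge.
Qed.

Lemma bounded_cmfun_local i (a : 'I_(d i)) : bounded_cmfun (fun g : env => local_state g a).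
Proof. by split; exact: bounded_mfun_coord. Qed.

(** This locality stands in for the independence of the parties. *)
Lemma local_indep i (a : 'I_(d i)) (g g' : env) :
  (forall k : key d, tag k.1 = i -> g k = g' k) -> local_state g a = local_state g' a.
Proof.
move=> gg'; rewrite !local_stateE.
have nn : nrm2 g i = nrm2 g' i by apply: eq_bigr => a' _; rewrite !gg'.
by rewrite nn !gg'.
Qed.

Lemma sum_local i (g : env) : nrm2 g i != 0 ->
  \sum_(a : 'I_(d i)) local_state g a * (local_state g a)^* = 1.
Proof.
move=> n0.
transitivity (\sum_(a : 'I_(d i)) Complex ((g (ckey a false) ^+ 2 + g (ckey a true) ^+ 2) /
  nrm2 g i) 0).
  apply: eq_bigr => a _; rewrite local_stateE; apply: complex_ext;
    rewrite ?complexReM ?complexImM complexReJ complexImJ /=; last by ring.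
  rewrite mulrN opprK -!expr2 !exprMn !exprVn sqr_sqrtr ?nrm2_ge0//; ring.
rewrite -(raddf_sum (real_complex R)) /= -mulr_suml -/(nrm2 g i) divff//.
Qed.

Section Party.
Variable i : 'I_n.

(** A quarter turn in the plane of real and imaginary part: multiplication of amplitude [a] by
    ['i]. *)
Definition phase (a : 'I_(d i)) : env -> env := rot (ckey a false) (ckey a true) 0 1.

Lemma nrm2_phase a g : nrm2 (phase a g) i = nrm2 g i.
Proof.
apply: eq_bigr => b _; rewrite /phase /rot !ckey_eq /= !andbT !andbF.
by case: eqVneq => [->|_] //; rewrite !mul0r !mul1r sub0r addr0 sqrrN addrC.
Qed.

Lemma local_phase a b g :
  local_state (phase a g) b = (if b == a then 'i%C else 1) * local_state g b.
Proof.
rewrite !local_stateE nrm2_phase /phase /rot !ckey_eq /= !andbT !andbF.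
by case: eqVneq => [->|_]; apply: complex_ext; rewrite ?complexReM ?complexImM /=; ring.
Qed.

(** The same rotation on real and on imaginary parts, that is, a real rotation of the basis vectors
    [a] and [b]. *)
Definition rot2 (a b : 'I_(d i)) (c r : R) : env -> env := fun g =>
  rot (ckey a true) (ckey b true) c r (rot (ckey a false) (ckey b false) c r g).

Lemma nrm2_rot2 a b c r g : a != b -> c ^+ 2 + r ^+ 2 = 1 ->
  nrm2 (rot2 a b c r g) i = nrm2 g i.
Proof.
move=> ab cr1; rewrite /nrm2 (bigD1 a)//= (bigD1 b)/=; last by rewrite eq_sym.
rewrite [in RHS](bigD1 a)//= [in RHS](bigD1 b)/=; last by rewrite eq_sym.
rewrite !addrA; congr (_ + _); last first.
  apply: eq_bigr => e /andP[ea eb].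
  by rewrite /rot2 /rot !ckey_eq /= !andbT !andbF (negbTE ea) (negbTE eb).
rewrite /rot2 /rot !ckey_eq /= !andbT !andbF !eqxx /= ?(negbTE ab) ?[b == a]eq_sym ?(negbTE ab).
set x := g _; set y := g _; set z := g _; set w := g _.
transitivity ((c ^+ 2 + r ^+ 2) * (x ^+ 2 + y ^+ 2 + z ^+ 2 + w ^+ 2)); first by ring.
by rewrite cr1 mul1r; ring.
Qed.

Lemma local_rot2 a b c r g : a != b -> c ^+ 2 + r ^+ 2 = 1 ->
  local_state (rot2 a b c r g) a = c%:C%C * local_state g a - r%:C%C * local_state g b.
Proof.
move=> ab cr1; rewrite !local_stateE nrm2_rot2//.
rewrite /rot2 /rot !ckey_eq /= !andbT !andbF !eqxx /= ?(negbTE ab).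
by apply: complex_ext; rewrite ?complexReD ?complexImD ?complexReM ?complexImM /=; ring.
Qed.

End Party.
End Moments.

Lemma cmean_rot (R : realType) (K : finType) (k l : K) (c r : R)
  (f : env R K -> (Num.RealClosedField.sort R)[i]) : k != l ->
  c ^+ 2 + r ^+ 2 = 1 -> 1 + c != 0 -> bounded_cmfun f ->
  cmean (env_law R K) (fun g : env R K => f (rot k l c r g)) = cmean (env_law R K) f.
Proof.
move=> kl cr1 c1 [f1 f2]; rewrite /cmean.
by congr Complex; [exact: (env_law_rot kl cr1 c1 f1)|exact: (env_law_rot kl cr1 c1 f2)].
Qed.

Lemma bounded_cmfun_rot (R : realType) (K : finType) (k l : K) (c r : R)
  (f : env R K -> (Num.RealClosedField.sort R)[i]) : bounded_cmfun f ->
  bounded_cmfun (fun g : env R K => f (rot k l c r g)).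
Proof.
by move=> [f1 f2]; split; [exact: (bounded_mfun_comp f1 (measurable_rot k l c r))|exact:
  (bounded_mfun_comp f2 (measurable_rot k l c r))].
Qed.

(** Expansion of a fourth moment of a combination of two amplitudes: of the sixteen terms ten
    vanish, four coincide, and two are pure fourth powers. *)
Lemma sum_bool4 (C : comRingType) (T : Type) (m : T -> T -> T -> T -> C) (a b : T) (p q : C) :
  let x (s : bool) := if s then b else a in
  let w (s : bool) := if s then q else p in
  m b b b a = 0 -> m b b a b = 0 -> m b a b b = 0 -> m a b b b = 0 -> m b a b a = 0 ->
  m a b a b = 0 -> m b a a a = 0 -> m a b a a = 0 -> m a a b a = 0 -> m a a a b = 0 ->
  m b b a a = m a a b b -> m a b b a = m a a b b -> m b a a b = m a a b b ->
  \sum_(s1 : bool) \sum_(s2 : bool) \sum_(s3 : bool) \sum_(s4 : bool)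
    w s1 * w s2 * w s3 * w s4 * m (x s1) (x s2) (x s3) (x s4) =
  p ^+ 4 * m a a a a + 4 * p ^+ 2 * q ^+ 2 * m a a b b + q ^+ 4 * m b b b b.
Proof.
move=> x w; rewrite !big_bool /x /w /=.
move=> -> -> -> -> -> -> -> -> -> -> -> -> ->; ring.
Qed.

Section Moment.
Context (R : realType) (n : nat) (d : 'I_n -> nat) (i : 'I_n).
Local Notation C := (Num.RealClosedField.sort R)[i].
Local Notation env := (env R (key d)).
Local Notation law := (env_law R (key d)).
Context (di : (0 < d i)%N) (H : env -> C) (bH : bounded_cmfun H).
Context (HI : forall g g' : env, (forall k : key d, tag k.1 != i -> g k = g' k) -> H g = H g').
Implicit Types a b c e x : 'I_(d i).

(** The factor [H] depends only on the other parties and stands for their monomials. Carrying it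
    along allows the average of a product to be computed one party at a time. *)
Let fm a b c e (g : env) : C :=
  local_state g a * (local_state g b)^* * (local_state g c * (local_state g e)^*) * H g.

Let bounded_cmfun_fm a b c e : bounded_cmfun (fm a b c e).
Proof.
have bu a' : bounded_cmfun (fun g : env => local_state g a') := bounded_cmfun_local R a'.
apply: bounded_cmfunM => //; apply: bounded_cmfunM; (apply: bounded_cmfunM;
  [exact: bu|exact/bounded_cmfun_conj/bu]).
Qed.

Let M a b c e := cmean law (fm a b c e).

Let rot_tag (x y : 'I_(d i)) (s t : bool) (c r : R) (g : env) (k : key d) : tag k.1 != i ->
  rot (ckey x s) (ckey y t) c r g k = g k.
Proof.
move=> ki; rewrite /rot; case: eqVneq => [kx|_]; first by rewrite kx /= eqxx in ki.
by case: eqVneq => [kx|//]; rewrite kx /= eqxx in ki.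
Qed.

Let H_phase x g : H (phase x g) = H g.
Proof. by apply: HI => k ki; exact: rot_tag. Qed.

Let H_rot2 (x y : 'I_(d i)) (c r : R) g : H (rot2 x y c r g) = H g.
Proof. by apply: HI => k ki; rewrite /rot2 rot_tag// rot_tag. Qed.

Let ph (b : bool) : C := if b then 'i%C else 1.

(** Invariance under the phase at [x] gives [M = z * M], where [z] is a power of ['i] whose exponent
    is the difference of the two counts. This exponent lies between -2 and 2 and is non-zero, hence
    [z != 1]. *)
Let M_phase x a b c e : ((a == x) + (c == x) != (b == x) + (e == x))%N -> M a b c e = 0.
Proof.
move=> ne; set z := ph (a == x) * (ph (b == x))^* * (ph (c == x) * (ph (e == x))^*).
have eM : M a b c e = z * M a b c e.
  rewrite -(cmeanZ _ _ (bounded_cmfun_fm a b c e)) {1}/M -[LHS](@cmean_rot _ _ (ckey x false)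
    (ckey x true) 0 1).
  - congr cmean; apply/funext => g; rewrite -/(phase x g) /fm H_phase !local_phase -!/(ph _).
    by rewrite /z !rmorphM; ring.
  - by rewrite ckey_eq andbF.
  - by rewrite expr0n expr1n add0r.
  - by rewrite addr0 oner_neq0.
  - exact: bounded_cmfun_fm.
have z1 : z != 1.
  apply/eqP => /(congr1 (@complex.Re _)); rewrite /z /ph.
  by move: ne; do 4 case: (_ == x) => //=;
    rewrite ?complexReM ?complexImM ?complexReJ ?complexImJ /=; move=> _; lra.
apply/eqP; move/eqP: eM; rewrite -subr_eq0 -{1}[M _ _ _ _]mul1r -mulrBl mulf_eq0 subr_eq0.
by rewrite eq_sym (negbTE z1).
Qed.

(** A non-zero moment has balanced counts at [x = a] and at [x = c], which forces [b, e] to be a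
    rearrangement of [a, c]. *)
Let M_unmatched a b c e : ~~ ((a == b) && (c == e) || (a == e) && (c == b)) -> M a b c e = 0.
Proof.
move=> nm.
have [//|] := eqVneq (M a b c e) 0 => nz; exfalso.
have h x : ((a == x) + (c == x) = (b == x) + (e == x))%N.
  by apply/eqP; apply: contraNT nz => /M_phase/eqP.
have pr : a == b -> c == b -> a == c by move=> /eqP-> /eqP->.
have qs : a == e -> c == e -> a == c by move=> /eqP-> /eqP->.
move: (h a) (h c) nm pr qs; rewrite !eqxx [c == a]eq_sym ![_ == a]eq_sym ![_ == c]eq_sym.
rewrite [c == a]eq_sym.
by case: (a == c); case: (a == b); case: (a == e); case: (c == b);
  case: (c == e) => //= _ _ _ h1 h2;
  [have := h1 isT isT|have := h2 isT isT].
Qed.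

Let M_swap a b : M a b b a = M a a b b.
Proof. by congr cmean; apply/funext => g; rewrite /fm; ring. Qed.

Let M_comm a b : M b b a a = M a a b b.
Proof. by congr cmean; apply/funext => g; rewrite /fm; ring. Qed.

(** The rotated amplitude is expanded inside the invariant moment; only matched terms survive, and
    the coefficient 4 counts the mixed ones. *)
Let M_rot a b (c r : R) : a != b -> c ^+ 2 + r ^+ 2 = 1 -> 1 + c != 0 ->
  M a a a a = (c ^+ 4)%:C%C * M a a a a + (4 * c ^+ 2 * r ^+ 2)%:C%C * M a a b b
            + (r ^+ 4)%:C%C * M b b b b.
Proof.
move=> ab cr1 c1.
pose x (s : bool) := if s then b else a.
(* The minus sign comes from [local_rot2] and disappears in the even powers that remain. *)
pose w (s : bool) : C := if s then - r%:C%C else c%:C%C.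
transitivity (\sum_(s1 : bool) \sum_(s2 : bool) \sum_(s3 : bool) \sum_(s4 : bool)
    w s1 * w s2 * w s3 * w s4 * M (x s1) (x s2) (x s3) (x s4)).
  transitivity (cmean law (fun g => fm a a a a (rot2 a b c r g))).
    have kk t : ckey a t != ckey b t by rewrite ckey_eq eqxx andbT.
    have f1 := cmean_rot (kk true) cr1 c1 (bounded_cmfun_fm a a a a).
    have f2 := cmean_rot (kk false) cr1 c1 (bounded_cmfun_rot (ckey a true) (ckey b true) c r
      (bounded_cmfun_fm a a a a)).
    exact: (esym (etrans f2 f1)).
  have bwm s1 s2 s3 s4 : bounded_cmfun (fun g => w s1 * w s2 * w s3 * w s4 * fm (x s1) (x s2)
    (x s3) (x s4) g).
    by apply: bounded_cmfunM => //; exact: bounded_cmfun_cst.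
  transitivity (cmean law (fun g => \sum_(s1 : bool) \sum_(s2 : bool) \sum_(s3 : bool) \sum_(s4
    : bool)
    w s1 * w s2 * w s3 * w s4 * fm (x s1) (x s2) (x s3) (x s4) g)).
    congr cmean; apply/funext => g; rewrite !big_bool /= /x /w /fm H_rot2 local_rot2//.
    have cr t : (t%:C%C)^* = t%:C%C :> C by apply: complex_ext;
      rewrite ?complexReJ ?complexImJ //= oppr0.
    have -> (u v : C) : (c%:C%C * u - r%:C%C * v)^* = c%:C%C * u^* - r%:C%C * v^*.
      by rewrite rmorphB !rmorphM /= !cr.
    ring.
  rewrite cmean_sum; last by do 4 (move=> ? _; try apply: bounded_cmfun_sum).
  apply: eq_bigr => s1 _; rewrite cmean_sum; last by do 3 (move=> ? _;
    try apply: bounded_cmfun_sum).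
  apply: eq_bigr => s2 _; rewrite cmean_sum; last by do 2 (move=> ? _;
    try apply: bounded_cmfun_sum).
  apply: eq_bigr => s3 _; rewrite cmean_sum; last by move=> ? _.
  by apply: eq_bigr => s4 _; rewrite cmeanZ.
have U e1 e2 e3 e4 := @M_unmatched e1 e2 e3 e4.
have ba : (b == a) = false by rewrite eq_sym (negbTE ab).
rewrite sum_bool4; try by apply: U; rewrite ?eqxx ?ba ?(negbTE ab).
- have e4 (t : R) : (t ^+ 4)%:C%C = t%:C%C ^+ 4 :> C by rewrite rmorphXn.
  have e2 (t : R) : (t ^+ 2)%:C%C = t%:C%C ^+ 2 :> C by rewrite rmorphXn.
  have two : (4 * c ^+ 2 * r ^+ 2)%:C%C = 4 * c%:C%C ^+ 2 * (- r%:C%C) ^+ 2 :> C.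
    rewrite sqrrN -e2 -e2 [LHS](rmorphM (real_complex R)); congr (_ * _).
    by rewrite [LHS](rmorphM (real_complex R)); congr (_ * _); rewrite /= rmorph_nat.
  have four : (- r%:C%C) ^+ 4 = (r ^+ 4)%:C%C :> C by rewrite e4 exprNn -signr_odd mul1r.
  by rewrite four two !e4.
- exact: M_comm.
- exact: M_swap.
- by rewrite M_swap M_comm.
Qed.

(** A quarter turn exchanges the two basis vectors up to sign. *)
Let M_diag a b : a != b -> M a a a a = M b b b b.
Proof.
move=> ab; rewrite (M_rot ab (c := 0) (r := 1)) ?expr0n ?expr1n ?add0r ?addr0 ?oner_neq0//=.
by rewrite !(mulr0, mul0r) !add0r mul1r.
Qed.

(* Rotation by any angle that is not a multiple of pi/2 would do. *)
Let M_pair a b : a != b -> M a a a a = 2 * M a a b b.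
Proof.
move=> ab; have := M_rot ab (c := 3 / 5) (r := 4 / 5).
have e1 : (3 / 5) ^+ 2 + (4 / 5) ^+ 2 = 1 :> R by field.
have e2 : 1 + 3 / 5 != 0 :> R by apply/eqP; lra.
move=> /(_ e1 e2); rewrite -(M_diag ab) => e.
have {}e : M a a a a = ((3 / 5) ^+ 4 + (4 / 5) ^+ 4)%:C%C * M a a a a
    + (4 * (3 / 5) ^+ 2 * (4 / 5) ^+ 2)%:C%C * M a a b b.
  by rewrite {1}e rmorphD /=; ring.
(* With [z = 2 c^2 r^2 = 288/625] one has [c^4 + r^4 = 1 - z] and [4 c^2 r^2 = 2 z], so a non-zero
   factor [z] cancels from the relation. *)
have p1 : (3 / 5) ^+ 4 + (4 / 5) ^+ 4 = 1 - 288 / 625 :> R by field.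
have p2 : 4 * (3 / 5) ^+ 2 * (4 / 5) ^+ 2 = 288 / 625 * 2 :> R by field.
set z : C := (288 / 625)%:C%C.
have z0 : z != 0.
  by rewrite -(rmorph0 (real_complex R)) (inj_eq (@complexI _)); apply/eqP; lra.
have two : (2 : R)%:C%C = 2 :> C by rewrite rmorph_nat.
have p1C : ((3 / 5) ^+ 4 + (4 / 5) ^+ 4)%:C%C = 1 - z :> C.
  by rewrite p1 [LHS](rmorphB (real_complex R)) rmorph1.
have p2C : (4 * (3 / 5) ^+ 2 * (4 / 5) ^+ 2)%:C%C = z * 2 :> C.
  by rewrite p2 [LHS](rmorphM (real_complex R)); congr (_ * _); exact: two.
move: e; rewrite p1C p2C; move: (M a a a a) (M a a b b) => v w e.
apply: (mulfI z0); rewrite mulrA -[RHS](addKr ((1 - z) * v)) -e; ring.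
Qed.

(* The normalisation fails only where the Gaussian vector vanishes (local_state is 0
   there, as x / 0 = 0), which is a null set. *)
Let M_total : \sum_a \sum_b M a a b b = cmean law H.
Proof.
have -> : \sum_a \sum_b M a a b b = cmean law (fun g => \sum_a \sum_b fm a a b b g).
  rewrite cmean_sum; last by move=> ? _; apply: bounded_cmfun_sum.
  by apply: eq_bigr => a _; rewrite cmean_sum.
(* The vector can vanish only where this one coordinate does, and that set is already null. *)
pose k0 := ckey (Ordinal di) false.
apply: (@cmean_ae _ _ _ _ _ _ [set g : env | g k0 = 0]%classic) => //.
- rewrite -[X in measurable X]setTI.
  exact: (measurable_coord k0 measurableT (measurable_set1 0)).
- exact: env_law_coord0.
- by apply: bounded_cmfun_sum => ? _; apply: bounded_cmfun_sum.
move=> g g0; have n0 : nrm2 g i != 0.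
  apply/eqP => z; apply: g0 => /=; apply/eqP.
  by rewrite -sqrf_eq0 eq_le sqr_ge0 andbT -z nrm2_ge.
transitivity ((\sum_(a : 'I_(d i)) local_state g a * (local_state g a)^*) *
  (\sum_(b : 'I_(d i)) local_state g b * (local_state g b)^*) * H g); last first.
  by rewrite sum_local// !mul1r.
rewrite mulr_suml mulr_suml; apply: eq_bigr => a _.
by rewrite mulr_sumr mulr_suml.
Qed.

(** These are the entries of [(1 + SWAP) / (d_i (d_i + 1))]. All matched moments are multiples of
    [M a a a a], whose value is then fixed by normalisation. *)
Lemma local_moment a b c e :
  cmean law (fun g => local_state g a * (local_state g b)^* *
    (local_state g c * (local_state g e)^*) * H g) =
  (((a == b) && (c == e))%:R + ((a == e) && (c == b))%:R) / (d i * (d i).+1)%:R * cmean law H.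
Proof.
rewrite -/(M a b c e).
have k0 : (d i * (d i).+1)%:R != 0 :> C by rewrite pnatr_eq0 -lt0n muln_gt0 di.
(* The factor is 1 on the diagonal and 1/2 off it. *)
have Mx x y : M x x y y = (x == y).+1%:R / 2 * M a a a a.
  have ax : M x x x x = M a a a a by have [->//|xa] := eqVneq x a; exact: M_diag.
  have [<-|xy] := eqVneq x y; first by rewrite ax divff ?mul1r ?pnatr_eq0.
  by rewrite -ax (M_pair xy) div1r mulKf ?pnatr_eq0.
have tot : (d i * (d i).+1)%:R / 2 * M a a a a = cmean law H.
  rewrite -M_total.
  transitivity (\sum_(x : 'I_(d i)) ((d i).+1%:R / 2 * M a a a a)).
    by rewrite sumr_const card_ord -mulr_natl natrM; ring.
  apply: eq_bigr => x _; rewrite (eq_bigr _ (fun y _ => Mx x y)) -mulr_suml; congr (_ * _).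
  rewrite -mulr_suml; congr (_ / _); rewrite -natr_sum; congr (_%:R).
  transitivity (\sum_(y : 'I_(d i)) (1 + (x == y)))%N; last by apply: eq_bigr.
  rewrite big_split /= sum1_card card_ord -addn1; congr (_ + _)%N.
  by rewrite (bigD1 x)//= eqxx big1 ?addn0// => y; rewrite eq_sym => /negbTE ->.
have alg (v K : C) : K != 0 -> v = 2 / K * (K / 2 * v) by move=> K0; field.
have inv2 : M a a a a = 2 / (d i * (d i).+1)%:R * cmean law H by rewrite -tot; exact: alg.
have alg2 (t : bool) (v K : C) : K != 0 -> t.+1%:R / 2 * (2 / K * v) = (1 + t%:R) / K * v.
  by move=> K0; case: t; field.
have [/orP[]/andP[/eqP<- /eqP<-]|nm] := boolP ((a == b) && (c == e) || (a == e) && (c == b)).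
- by rewrite !eqxx /= [c == a]eq_sym andbb Mx inv2; exact: alg2.
- by rewrite M_swap !eqxx /= [c == a]eq_sym andbb Mx inv2 alg2// [1 + _]addrC.
rewrite M_unmatched//; move: nm; rewrite negb_or => /andP[/negbTE-> /negbTE->].
by rewrite addr0 !mul0r.
Qed.

End Moment.

(** * Purity of the marginals of a bipartite vector *)

Section Purity.
Context (C : numClosedFieldType) (Z A B : finType) (pi : Z -> A) (sg : Z -> B) (W : Z -> C).

(** The unnormalised purity of the vector [W], whose basis label [z] splits into a part [pi z] and a
    part [sg z]. Written as one sum over quadruples, it can be averaged term by term. *)
Definition purity4 : C := \sum_(z : (Z * Z) * (Z * Z))
  [&& pi z.1.1 == pi z.1.2, pi z.2.1 == pi z.2.2, sg z.1.2 == sg z.2.1 & sg z.1.1 == sg z.2.2]%:R *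
  (W z.1.1 * (W z.1.2)^* * (W z.2.1 * (W z.2.2)^*)).

(** The reduced operator on the [B] side, with the shape of [ptrace]. *)
Definition marginal (a b : B) : C := \sum_z
  \sum_(z' | [&& sg z == a, sg z' == b & pi z == pi z']) W z * (W z')^*.

Lemma sum_delta (F : B -> C) x : \sum_a (x == a)%:R * F a = F x.
Proof.
rewrite (bigD1 x)//= eqxx mul1r big1 ?addr0// => a ax.
by rewrite eq_sym (negbTE ax) mul0r.
Qed.

Lemma sum_marginal : \sum_a \sum_b marginal a b * marginal b a = purity4.
Proof.
pose f a b (z : Z * Z) := (sg z.1 == a)%:R * ((sg z.2 == b)%:R *
   ((pi z.1 == pi z.2)%:R * (W z.1 * (W z.2)^*))).
have mE a b : marginal a b = \sum_(z : Z * Z) f a b z.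
  rewrite /marginal pair_big_dep/= big_mkcond; apply: eq_bigr => -[z z'] _ /=; rewrite /f/=.
  by case: eqP => _; case: eqP => _; case: eqP => _; rewrite /= ?mul0r ?mul1r ?mul0r ?mulr0.
transitivity (\sum_a \sum_b \sum_(z : (Z * Z) * (Z * Z)) f a b z.1 * f b a z.2).
  by apply: eq_bigr => a _; apply: eq_bigr => b _; rewrite !mE big_distrlr/= pair_bigA.
under eq_bigr do rewrite exchange_big/=.
rewrite exchange_big/=; apply: eq_bigr => -[[z1 z2] [z3 z4]] _ /=.
rewrite /f /=.
transitivity (\sum_a (sg z1 == a)%:R * \sum_b (sg z2 == b)%:R *
  ((pi z1 == pi z2)%:R * (W z1 * (W z2)^*) *
   ((sg z3 == b)%:R * ((sg z4 == a)%:R * ((pi z3 == pi z4)%:R * (W z3 * (W z4)^*)))))).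
  apply: eq_bigr => a _; rewrite mulr_sumr; apply: eq_bigr => b _; ring.
rewrite sum_delta sum_delta [sg z3 == _]eq_sym [sg z4 == _]eq_sym.
by do 4 case: (_ == _); rewrite /= ?mul0r ?mul1r ?mul0r ?mulr0.
Qed.

Lemma marginalC a b : marginal b a = (marginal a b)^*.
Proof.
rewrite /marginal rmorph_sum /= (exchange_big_dep predT)//=.
apply: eq_bigr => z _; rewrite rmorph_sum; apply: eq_big => [z'|z' _].
  by rewrite [pi z' == _]eq_sym andbCA.
by rewrite rmorphM /= conjCK mulrC.
Qed.

Hypothesis inj : forall z z', pi z = pi z' -> sg z = sg z' -> z = z'.

Lemma marginal_diag a : marginal a a = \sum_(z | sg z == a) W z * (W z)^*.
Proof.
rewrite /marginal [RHS]big_mkcond; apply: eq_bigr => z _; case: eqP => [za|za].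
  rewrite (big_pred1 z)// => z'; apply/idP/eqP => [/and3P[_ /eqP za' /eqP zz]|->].
    by apply: inj; rewrite ?za'.
  by rewrite za !eqxx.
by rewrite big_pred0.
Qed.

(** The off-diagonal entries contribute squared moduli and are dropped; the diagonal is non-negative
    with sum [N], and Cauchy-Schwarz bounds its sum of squares. *)
Lemma purity4_ge : (0 < #|B|)%N ->
  (\sum_z W z * (W z)^*) ^+ 2 / #|B|%:R <= purity4.
Proof.
move=> B0; set N := \sum_z _.
have r0 a : 0 <= marginal a a.
  by rewrite marginal_diag; apply: sumr_ge0 => z _; exact: mul_conjC_ge0.
have rN : \sum_a marginal a a = N.
  rewrite (eq_bigr _ (fun a _ => marginal_diag a)) /N (partition_big sg predT)//=.
apply: (@le_trans _ _ (\sum_a marginal a a ^+ 2)); last first.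
  rewrite -sum_marginal; apply: ler_sum => a _; rewrite (bigD1 a)//= -expr2 lerDl.
  by apply: sumr_ge0 => b _; rewrite [marginal b a]marginalC mul_conjC_ge0.
have N0 : 0 <= N by rewrite -rN; apply: sumr_ge0.
pose m := N / #|B|%:R.
have B0' : #|B|%:R != 0 :> C by rewrite pnatr_eq0 -lt0n.
(* Cauchy-Schwarz in variance form: the deviations from the mean [m] have a non-negative sum of
   squares. *)
have : 0 <= \sum_a (marginal a a - m) ^+ 2.
  apply: sumr_ge0 => a _; apply: real_exprn_even_ge0 => //.
  by apply: realB; apply: ger0_real => //; rewrite divr_ge0.
suff -> : \sum_a (marginal a a - m) ^+ 2 = \sum_a marginal a a ^+ 2 - N ^+ 2 / #|B|%:R.
  by rewrite subr_ge0.
transitivity (\sum_a (marginal a a ^+ 2 - 2 * m * marginal a a + m ^+ 2)).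
  by apply: eq_bigr => a _; ring.
rewrite big_split /= sumrB -mulr_sumr rN sumr_const -[_ *+ #|_|]mulr_natr /m.
by field.
Qed.

End Purity.

(** The two marginals of a vector have equal purity: exchanging the second and fourth labels of a
    quadruple swaps the roles of [pi] and [sg]. *)
Lemma purity4C (C : numClosedFieldType) (Z A B : finType) (pi : Z -> A) (sg : Z -> B) (W : Z -> C) :
  purity4 pi sg W = purity4 sg pi W.
Proof.
pose h (z : (Z * Z) * (Z * Z)) := ((z.1.1, z.2.2), (z.2.1, z.1.2)).
rewrite /purity4 (reindex_inj (h := h)); last first.
  by move=> [[? ?] [? ?]] [[? ?] [? ?]] [] -> -> -> ->.
apply: eq_bigr => -[[z1 z2] [z3 z4]] _ /=; congr (_%:R * _); last by ring.
by rewrite [pi z3 == _]eq_sym [sg z4 == _]eq_sym; do 4 case: (_ == _).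
Qed.

Lemma purity4_ge_min (C : numClosedFieldType) (Z A B : finType) (pi : Z -> A) (sg : Z -> B)
    (W : Z -> C) : (0 < #|A|)%N -> (0 < #|B|)%N ->
  (forall z z', pi z = pi z' -> sg z = sg z' -> z = z') ->
  (\sum_z W z * (W z)^*) ^+ 2 / (minn #|A| #|B|)%:R <= purity4 pi sg W.
Proof.
move=> A0 B0 inj; rewrite /minn; case: ifP => _; last exact: purity4_ge.
by rewrite purity4C; apply: purity4_ge => // z z' sz pz; exact: inj.
Qed.

(** * Mean purity of the output state *)

Section Average.
Context (R : realType) (n : nat) (d : 'I_n -> nat) (hd : forall i, (0 < d i)%N).
Local Notation C := (Num.RealClosedField.sort R)[i].
Local Notation env := (env R (key d)).
Local Notation law := (env_law R (key d)).
Local Notation quad T := ((T * T) * (T * T))%type.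

Definition quad_monomial (T : Type) (f : T -> C) (t : quad T) : C :=
  f t.1.1 * (f t.1.2)^* * (f t.2.1 * (f t.2.2)^*).

Let local_monomial (t : quad (idx d)) (i : 'I_n) (g : env) : C :=
  local_state g (t.1.1 i) * (local_state g (t.1.2 i))^* *
  (local_state g (t.2.1 i) * (local_state g (t.2.2 i))^*).

Let bounded_cmfun_local_monomial t i : bounded_cmfun (local_monomial t i).
Proof.
have bu (a : 'I_(d i)) : bounded_cmfun (fun g : env => local_state g a) := bounded_cmfun_local R a.
by apply: bounded_cmfunM; (apply: bounded_cmfunM; [exact: bu|exact/bounded_cmfun_conj/bu]).
Qed.

Lemma quad_monomial_sep (t : quad (idx d)) (g : env) :
  quad_monomial (sep_state g) t = \prod_i local_monomial t i g.
Proof. by rewrite /quad_monomial /sep_state !rmorph_prod -!big_split. Qed.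

Lemma bounded_cmfun_quad_monomial_sep t : bounded_cmfun (fun g : env => quad_monomial
  (sep_state g) t).
Proof.
rewrite (_ : (fun _ => _) = (fun g : env => \prod_i local_monomial t i g)).
  by apply: bounded_cmfun_prod => i _; exact: bounded_cmfun_local_monomial.
by apply/funext => g; exact: quad_monomial_sep.
Qed.

(** The entry of [1 + SWAP_i] at the labels of party [i]. *)
Definition pairing (t : quad (idx d)) (i : 'I_n) : C :=
  ((t.1.1 i == t.1.2 i) && (t.2.1 i == t.2.2 i))%:R +
  ((t.1.1 i == t.2.2 i) && (t.2.1 i == t.1.2 i))%:R.

(** Induction over the parties: [local_moment] evaluates one of them, with the product over the
    remaining ones as [H]. *)
Lemma cmean_quad_monomial t :
  cmean law (fun g : env => quad_monomial (sep_state g) t) =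
  \prod_i (pairing t i / (d i * (d i).+1)%:R).
Proof.
transitivity (cmean law (fun g : env => \prod_i local_monomial t i g)).
  by congr cmean; apply/funext => g; exact: quad_monomial_sep.
have := index_enum_uniq 'I_n; elim: (index_enum _) => [|i s IH] /=.
  move=> _; rewrite big_nil -[RHS](cmean_cst law); congr cmean; apply/funext => g.
  by rewrite big_nil.
move=> /andP[is_ us]; rewrite big_cons -IH//.
rewrite -(@local_moment _ _ _ i (hd i) (fun g => \prod_(j <- s) local_monomial t j g)).
- by congr cmean; apply/funext => g; rewrite big_cons.
- by apply: bounded_cmfun_prod => j _; exact: bounded_cmfun_local_monomial.
move=> g g' gg'; apply: eq_big_seq => j js; rewrite /local_monomial.
have ji : j != i by apply: contraNneq is_ => <-.
have e (a : 'I_(d j)) : local_state g a = local_state g' a.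
  by apply: local_indep => k kj; apply: gg'; rewrite kj.
by rewrite !e.
Qed.

Lemma restr_eq (X : {set 'I_n}) (x y : idx d) :
  (restr X x == restr X y) = [forall i, (i \in X) ==> (x i == y i)].
Proof.
apply/eqP/forallP => [xy i|xy].
  apply/implyP => iX; apply/eqP.
  by have := congr1 (fun f : sidx d X => f (exist _ i iX)) xy; rewrite /restr !ffunE.
apply/ffunP => -[i iX]; rewrite !ffunE /=; apply/eqP.
by have := xy i; rewrite iX.
Qed.

Lemma prod_natb (b : 'I_n -> bool) : \prod_i (b i)%:R = [forall i, b i]%:R :> C.
Proof.
case: (boolP [forall i, b i]) => [/forallP h|].
  by rewrite big1// => i _; rewrite h.
by rewrite negb_forall => /existsP[i /negbTE bi]; rewrite (bigD1 i)//= bi mul0r.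
Qed.

(** Identity pairing on [X], swap pairing elsewhere. This is also the condition in [purity4] for the
    splitting of the parties into [X] and its complement. *)
Definition paired (X : {set 'I_n}) (t : quad (idx d)) : bool :=
  [&& restr X t.1.1 == restr X t.1.2, restr X t.2.1 == restr X t.2.2,
      restr (~: X) t.1.2 == restr (~: X) t.2.1 & restr (~: X) t.1.1 == restr (~: X) t.2.2].

(** Distributing the product over the sums, [X] collects the parties where the identity term is
    chosen. *)
Lemma prod_pairing t : \prod_i pairing t i = \sum_(X : {set 'I_n}) (paired X t)%:R.
Proof.
rewrite /pairing bigA_distr; apply: eq_bigr => X _.
transitivity (\prod_i (if i \in X then (t.1.1 i == t.1.2 i) && (t.2.1 i == t.2.2 i)
   else (t.1.1 i == t.2.2 i) && (t.2.1 i == t.1.2 i))%:R : C).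
  by apply: eq_bigr => i _; case: ifP.
rewrite prod_natb /paired !restr_eq; congr (_%:R); congr nat_of_bool.
apply/forallP/and4P => [h|[/forallP h1 /forallP h2 /forallP h3 /forallP h4] i].
  split; apply/forallP => i; apply/implyP; rewrite ?inE => iX; have := h i.
  - by rewrite iX => /andP[].
  - by rewrite iX => /andP[].
  - by rewrite (negbTE iX) eq_sym => /andP[_]; rewrite eq_sym.
  - by rewrite (negbTE iX) => /andP[].
have := h1 i; have := h2 i; have := h3 i; have := h4 i; rewrite !inE.
by case: (i \in X) => /=; [move=> _ _ -> ->|move=> -> e _ _; rewrite eq_sym].
Qed.

Definition kappa : C := \prod_(i < n) ((d i * (d i).+1)%:R)^-1.

Lemma cmean_quad_monomialE t :
  cmean law (fun g : env => quad_monomial (sep_state g) t) =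
  kappa * \sum_(X : {set 'I_n}) (paired X t)%:R.
Proof. by rewrite cmean_quad_monomial big_split /= -/kappa prod_pairing mulrC. Qed.

Variable U : idx d -> idx d -> C.

Lemma quad_monomial_apply (psi : idx d -> C) (z : quad (idx d)) :
  quad_monomial (apply_op U psi) z =
  \sum_(t : quad (idx d)) quad_monomial (fun w : idx d * idx d => U w.1 w.2)
     ((z.1.1, t.1.1), (z.1.2, t.1.2), ((z.2.1, t.2.1), (z.2.2, t.2.2))) * quad_monomial psi t.
Proof.
have pr (x y : idx d) : apply_op U psi x * (apply_op U psi y)^* =
    \sum_(t : idx d * idx d) U x t.1 * psi t.1 * (U y t.2 * psi t.2)^*.
  by rewrite /apply_op rmorph_sum big_distrlr /= pair_bigA.
rewrite /quad_monomial !pr big_distrlr /= pair_bigA /=.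
by apply: eq_bigr => -[[t1 t2] [t3 t4]] _ /=; rewrite !rmorphM; ring.
Qed.

(** The matrix of [U] is read as a vector with output labels in H and input labels in H'. *)
Definition op_purity (p X : {set 'I_n}) : C :=
  purity4 (fun w : idx d * idx d => (restr p w.1, restr X w.2))
    (fun w => (restr (~: p) w.1, restr (~: X) w.2)) (fun w => U w.1 w.2).

Definition out_purity (p : {set 'I_n}) (g : env) : C :=
  trsq (ptrace (p := p) (Defs.proj (apply_op U (sep_state g)))).

Lemma out_purityE p g : out_purity p g =
  \sum_(z : quad (idx d)) \sum_(t : quad (idx d)) (paired p z)%:R *
    quad_monomial (fun w : idx d * idx d => U w.1 w.2)
     ((z.1.1, t.1.1), (z.1.2, t.1.2), ((z.2.1, t.2.1), (z.2.2, t.2.2))) *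
    quad_monomial (sep_state g) t.
Proof.
(* The partial trace of a projector unfolds to [marginal]. *)
transitivity (purity4 (restr p) (restr (~: p)) (apply_op U (sep_state g))).
  by rewrite -sum_marginal.
apply: eq_bigr => z _; rewrite -/(paired p z) -/(quad_monomial _ z) quad_monomial_apply mulr_sumr.
by apply: eq_bigr => t _; rewrite mulrA.
Qed.

Lemma bounded_cmfun_out_purity p : bounded_cmfun (out_purity p).
Proof.
rewrite (funext (out_purityE p)).
apply: bounded_cmfun_sum => z _; apply: bounded_cmfun_sum => t _; apply: bounded_cmfunM;
  first exact: bounded_cmfun_cst.
exact: bounded_cmfun_quad_monomial_sep.
Qed.

(** The output labels are paired along [p] by the purity, the input labels along [X] by the average;
    jointly this is the pairing along [(p, X)]. *)
Lemma cmean_out_purity p : cmean law (out_purity p) = kappa * \sum_(X : {set 'I_n}) op_purity p X.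
Proof.
rewrite (funext (out_purityE p)).
have bm (a : C) t : bounded_cmfun (fun g : env => a * quad_monomial (sep_state g) t).
  by apply: bounded_cmfunM; [exact: bounded_cmfun_cst|exact: bounded_cmfun_quad_monomial_sep].
rewrite cmean_sum; last by move=> z _; apply: bounded_cmfun_sum => t _; exact: bm.
rewrite /op_purity /purity4 exchange_big /=.
(* Interleaves a quadruple of outputs and a quadruple of inputs into a quadruple of pairs. *)
pose h (w : quad (idx d) * quad (idx d)) : quad (idx d * idx d) :=
  ((w.1.1.1, w.2.1.1), (w.1.1.2, w.2.1.2), ((w.1.2.1, w.2.2.1), (w.1.2.2, w.2.2.2))).
rewrite (reindex h) /=; last first.
  exists (fun w => ((w.1.1.1, w.1.2.1, (w.2.1.1, w.2.2.1)), (w.1.1.2, w.1.2.2, (w.2.1.2,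
    w.2.2.2)))).
    by move=> [[[? ?] [? ?]] [[? ?] [? ?]]].
  by move=> [[[? ?] [? ?]] [[? ?] [? ?]]].
have pb (G : quad (idx d) * quad (idx d) -> C) : \sum_w G w = \sum_z \sum_t G (z, t).
  by rewrite pair_bigA; apply: eq_bigr => -[].
rewrite pb mulr_sumr /=.
apply: eq_bigr => z _; rewrite cmean_sum; last by move=> t _; exact: bm.
rewrite mulr_sumr; apply: eq_bigr => t _.
rewrite cmeanZ; last exact: bounded_cmfun_quad_monomial_sep.
rewrite cmean_quad_monomialE mulrCA; congr (_ * _).
rewrite mulr_sumr; apply: eq_bigr => X _.
rewrite mulrAC -/(quad_monomial _ _) /quad_monomial /=; congr (_ * _).
rewrite -natrM mulnb; congr (_%:R); congr nat_of_bool; rewrite /paired !xpair_eqE.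
by do 8 case: (_ == _).
Qed.

End Average.

(** * Lower bound on the mean purity and upper bound on the mean tangle *)

Section Bound.
Context (R : realType) (n : nat) (d : 'I_n -> nat) (hd : forall i, (0 < d i)%N).
Local Notation C := (Num.RealClosedField.sort R)[i].
Local Notation law := (env_law R (key d)).

Lemma dprod_gt0 (S : {set 'I_n}) : (0 < dprod d S)%N.
Proof. by rewrite /dprod prodn_gt0. Qed.

Lemma card_sidx (S : {set 'I_n}) : #|{: sidx d S}| = dprod d S.
Proof.
rewrite card_dep_ffun foldrE big_map big_enum /= /dprod [in RHS]big_sub.
by apply: eq_bigr => i _; rewrite card_ord.
Qed.

Lemma card_idx : #|{: idx d}| = (\prod_i d i)%N.
Proof.
rewrite card_dep_ffun foldrE big_map big_enum /=.
by apply: eq_bigr => i _; rewrite card_ord.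
Qed.

Lemma restr_inj (p : {set 'I_n}) (x y : idx d) :
  restr p x = restr p y -> restr (~: p) x = restr (~: p) y -> x = y.
Proof.
move=> /eqP; rewrite restr_eq => /forallP h1 /eqP; rewrite restr_eq => /forallP h2.
apply/ffunP => i; apply/eqP; have := h1 i; have := h2 i; rewrite inE.
by case: (i \in p).
Qed.

Variable U : idx d -> idx d -> C.
Hypothesis hU : unitary U.

(** Each of the [D] columns of a unitary has norm one. *)
Lemma sum_unitary :
  \sum_(w : idx d * idx d) U w.1 w.2 * (U w.1 w.2)^* = (\prod_i d i)%N%:R.
Proof.
transitivity (\sum_x \sum_y U x y * (U x y)^*); first by rewrite pair_bigA.
rewrite exchange_big /= -card_idx -sum1_card natr_sum; apply: eq_bigr => y _.
have := hU y y; rewrite eqxx => <-.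
by apply: eq_bigr => x _; rewrite mulrC.
Qed.

Definition mindim (p X : {set 'I_n}) : nat :=
  minn (dprod d p * dprod d X)%N (dprod d (~: p) * dprod d (~: X))%N.

Lemma mindim_gt0 p X : (0 < mindim p X)%N.
Proof. by rewrite /mindim leq_min !muln_gt0 !dprod_gt0. Qed.

Lemma op_purity_ge p X :
  (\prod_i d i)%N%:R ^+ 2 / (mindim p X)%:R <= op_purity U p X.
Proof.
rewrite -sum_unitary /mindim -!card_sidx -!card_prod.
apply: (purity4_ge_min (C := C)).
- by rewrite card_prod !card_sidx muln_gt0 !dprod_gt0.
- by rewrite card_prod !card_sidx muln_gt0 !dprod_gt0.
move=> [x y] [x' y'] /= [h1 h2] [h3 h4].
by congr (_, _); [exact: restr_inj h1 h3|exact: restr_inj h2 h4].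
Qed.

Definition ratio : R := \prod_(i < n) ((d i)%:R / (d i).+1%:R).

(** The [D^2] from the purity bound cancels one [d_i] per party and leaves [d_i / (d_i + 1)]. *)
Lemma kappaE : kappa R d * (\prod_i d i)%N%:R ^+ 2 = ratio%:C%C.
Proof.
rewrite /kappa /ratio (rmorph_prod (real_complex R)) natr_prod -prodrXl -big_split /=.
apply: eq_bigr => i _; rewrite fmorph_div !rmorph_nat natrM.
have d0 : (d i)%:R != 0 :> C by rewrite pnatr_eq0 -lt0n hd.
have d1 : (d i).+1%:R != 0 :> C by rewrite pnatr_eq0.
by move: (_%:R) (_.+1%:R) d0 d1 => u v u0 v0; field; rewrite u0 v0.
Qed.

Lemma Re_out_purity_ge p :
  ratio * \sum_(X : {set 'I_n}) (mindim p X)%:R^-1 <=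
  complex.Re (cmean law (out_purity U p)).
Proof.
have h : (ratio * \sum_(X : {set 'I_n}) (mindim p X)%:R^-1)%:C%C <= cmean law (out_purity U p).
  rewrite (cmean_out_purity hd) (rmorphM (real_complex R)) /= -kappaE -mulrA ler_wpM2l//.
    by rewrite /kappa prodr_ge0// => i _; rewrite invr_ge0.
  rewrite rmorph_sum mulr_sumr; apply: ler_sum => X _.
  by rewrite fmorphV rmorph_nat; exact: op_purity_ge.
(* The order on complex numbers compares real parts and requires equal imaginary parts; the former
   is kept. *)
by move: h; case: (cmean law _) => a b; rewrite lecE => /andP[].
Qed.

Lemma epsE p : eps p U = (2 * (1 - complex.Re (cmean law (out_purity U p))))%:E.
Proof.
have [bRe _] := bounded_cmfun_out_purity U p.
have bd : bounded_mfun (fun g : env R (key d) => 1 - complex.Re (out_purity U p g)).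
  by apply: bounded_mfunB => //; exact: bounded_mfun_cst.
have bt : bounded_mfun (fun g : env R (key d) => tau p (apply_op U (sep_state g))).
  by apply: bounded_mfunM => //; exact: bounded_mfun_cst.
rewrite /eps gauss_avgE//.
transitivity (\int[law]_g tau p (apply_op U (sep_state g)))%R%:E.
  by rewrite fineK//; apply: integrable_fin_num => //; exact: bounded_mfun_integrable.
congr (_%:E); rewrite RintegralZl//; last exact: bounded_mfun_integrable.
congr (_ * _); rewrite RintegralB//; try (exact: bounded_mfun_integrable).
  by congr (_ - _); rewrite Rintegral_cst//= [law _]probability_setT mulr1.
by apply: bounded_mfun_integrable; exact: bounded_mfun_cst.
Qed.

Lemma eps_le p : (eps p U <= (eps_tilde R d p)%:E)%E.
Proof.
rewrite epsE lee_fin.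
have -> : eps_tilde R d p = 2 - 2 * (ratio * \sum_(X : {set 'I_n}) (mindim p X)%:R^-1).
  rewrite /eps_tilde -mulrA; congr (_ - _ * (_ * _)).
  (* The [2 ^+ n] is a sum of ones over all subsets, and [1 - (m - 1) / m] is [1 / m]. *)
  transitivity (\sum_(X : {set 'I_n}) (1 - ((mindim p X)%:R - 1) / (mindim p X)%:R) : R).
    rewrite sumrB; congr (_ - _).
    by rewrite sumr_const -cardsT -powersetT card_powerset cardsT card_ord natrX.
  apply: eq_bigr => X _.
  have m0 : (mindim p X)%:R != 0 :> R by rewrite pnatr_eq0 -lt0n mindim_gt0.
  by field.
rewrite mulrBr mulr1 lerB// ler_pM2l//; exact: Re_out_purity_ge.
Qed.

End Bound.

Theorem theorem5 (R : realType) (n : nat) (d : 'I_n -> nat)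
  (hd : forall i, (0 < d i)%N)
  (U : idx d -> idx d -> R[i]) (hU : unitary U) :
  (forall p : {set 'I_n}, p != finset.set0 -> p != [set: 'I_n] ->
     (eps p U <= (eps_tilde R d p)%:E)%E)
  /\ (eps1 U <= (eps1_tilde R d)%:E)%E.
Proof.
split=> [p _ _|]; first exact: (eps_le hd hU p).
(* The prefactor is non-negative for every [n]; for [n <= 1] it is the inverse of 0, which is 0. *)
rewrite /eps1 /eps1_tilde EFinM lee_wpmul2l//.
  by rewrite lee_fin invr_ge0 subr_ge0 exprn_ege1// ler1n.
by rewrite -sumEFin; apply: lee_sum => P _; exact: (eps_le hd hU (brep P)).
Qed.
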